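(* Let $N,T\geqslant 1$ be real numbers, $k$ a positive integer, $\mathcal{A}\subseteq[0,T]$ a well spaced set and $(a_n)$ a sequence of complex numbers with $|a_n|\leqslant 1$. Then $$\sum_{t_1,\dots,t_{2k}\in\mathcal{A}}\left|\sum_{N\leqslant n\leqslant 2N}a_n n^{-1/2+i(t_1+\dots+t_k-t_{k+1}-\dots-t_{2k})}\right|^2\ll \left(|\mathcal{A}|^{2k}+NT_k(\mathcal{A})+T^{1/2}|\mathcal{A}|^{k/2}T_k(\mathcal{A})^{3/4}\right)N^{o(1)}.$$ In particular, if either $N\geqslant T^{2/3}$ or $T^{2/3}T_k(\mathcal{A})\leqslant|\mathcal{A}|^{2k}$, then $$\sum_{t_1,\dots,t_{2k}\in\mathcal{A}}\left|\sum_{N\leqslant n\leqslant 2N}a_n n^{-1/2+i(t_1+\dots+t_k-t_{k+1}-\dots-t_{2k})}\right|^2\ll \left(|\mathcal{A}|^{2k}+NT_k(\mathcal{A})\right)(NT)^{o(1)}.$$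
   Context: A set $\mathcal{A}\subset\mathbb{R}$ is well spaced if $|t-t'|\geqslant 1$ for distinct $t,t'\in\mathcal{A}$. The additive energy $T_k(\mathcal{A})$ is the number of tuples $(t_1,\dots,t_{2k})\in\mathcal{A}^{2k}$ with $|t_1+\dots+t_k-t_{k+1}-\dots-t_{2k}|\leqslant 1$. It is assumed that $T^{o(1)}\leqslant N\leqslant T^{O(1)}$; factors $N^{o(1)}$, $(NT)^{o(1)}$ mean $N^{\varepsilon}$, $(NT)^{\varepsilon}$ for any fixed $\varepsilon>0$, implied constants depending on $\varepsilon$ and $k$. *)

(* Defs.v *)
From HB Require Import structures.
From mathcomp Require Export all_boot all_order all_algebra.
From mathcomp Require Export finmap.
From mathcomp Require Export complex.
From mathcomp Require Export all_classical all_reals all_analysis.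

Set Implicit Arguments.
Unset Strict Implicit.
Unset Printing Implicit Defensive.

Import Order.TTheory GRing.Theory Num.Theory.

Local Open Scope ring_scope.

Section WellSpacedEnergy.
Variable R : realType.
Implicit Types (A : {fset R}) (k : nat).

Definition well_spaced A : Prop :=
  forall t u : R, t \in A -> u \in A -> t != u -> 1 <= `|t - u|.

(* t_1 + ... + t_k - t_(k+1) - ... - t_(2k), for a 2k-tuple of elements of A
   indexed by 'I_(k + k). *)
Definition alt_sum A k (t : {ffun 'I_(k + k) -> A}) : R :=
  \sum_(j < k) val (t (lshift k j)) - \sum_(j < k) val (t (rshift k j)).

Definition additive_energy k A : nat :=
  #|[set t : {ffun 'I_(k + k) -> A} | `|alt_sum t| <= 1]|.

End WellSpacedEnergy.

Section DirichletPolynomial.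
Variable R : realType.

(* x ^ s = exp (s * ln x), with the principal (real) logarithm; meaningful for
   0 < x. *)
Definition cpow (x : R) (s : complex R) : complex R :=
  let r := expR (complex.Re s * ln x) in
  let theta := complex.Im s * ln x in
  Complex (r * cos theta) (r * sin theta).

(* The sum of a_n n^s over the integers n with N <= n <= 2N, for real N >= 0. *)
Definition dirichlet_poly (N : R) (a : nat -> complex R) (s : complex R) :
    complex R :=
  \sum_(0 <= n < (Num.truncn (2 * N)).+1 | N <= n%:R) a n * cpow n%:R s.

(* Normc.normc is the R-valued modulus, whereas `|_| on complex R is complex
   valued. *)
Definition energy_mean_square (k : nat) (A : {fset R}) (N : R)
    (a : nat -> complex R) : R :=
  \sum_(t : {ffun 'I_(k + k) -> A})
    Normc.normc (dirichlet_poly N a (Complex (- (1 / 2)) (alt_sum t))) ^+ 2.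

End DirichletPolynomial.

(* Main.v *)
(** By positivity the coefficients can be replaced by 1.  With F(y) the sum of
cos(tau y) over the alternating sums tau of the 2k-tuples, F = |R|^(2k) >= 0
for R(y) = \sum_(t in A) e^(iyt), and the mean square is at most
  G(2N), where G(K) = \sum_(m, n <= K) (m n)^(-1/2) F(log m - log n).
As in Heath-Brown's large values estimate, G is controlled by three facts, up
to factors (NT)^o(1), with E = T_k(A) and X = |A|^(2k):
- monotonicity: G(K) is at most L^(-1) times the sum of F(log m - log n) over
  L <= m, n < 4L, for every L >= K, because each pair m, n arises from few
  common multiples;
- squaring: G(K)^2 <= X G(K^2), by Cauchy-Schwarz and the divisor bound;
- reflection: G(K) << L E + G(2kT / L) for L >= K.
Reflection is proved without Poisson summation.  As |tau| <= kT, the function F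
hardly varies on intervals of length 1 / (2kT), so the sum over m, n ~ L is an
integral of F(y) weighted by the number of m, n ~ L with log(m/n) that close
to y, i.e. |m - n e^y| << L / (kT).  By the geometry of numbers in dimension 2
this number is at most L^2 / (kT) times 1 plus the number of (l, h) with
h << kT / L and |l - h e^y| << 1 / L.  The term 1 contributes L E, and the dual
points contribute G at length about kT / L.
Finally, reflecting, squaring and using monotonicity gives G(P) << P E + X when
P^3 >= (2kT)^2, and a further reflection and squaring reduces to such a P. *)
From HB Require Import structures.
From mathcomp Require Import ring lra zify measurable_realfun.
Require Import Defs.

Set Implicit Arguments.
Unset Strict Implicit.
Unset Printing Implicit Defensive.

Import Order.TTheory GRing.Theory Num.Theory.
Import numFieldNormedType.Exports.

Local Open Scope ring_scope.

(** * Quadratic forms in trigonometric sums *)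

Lemma mean_value (R : realType) (f df : R -> R) (a b : R) : a <= b ->
  (forall x : R, is_derive x 1 f (df x)) ->
  exists2 c, a <= c <= b & f b - f a = df c * (b - a).
Proof.
move=> ab fdf.
have fc : {within `[a, b], continuous f}%classic.
  apply: continuous_subspaceT => x; apply: differentiable_continuous.
  by apply/derivable1_diffP; case: (fdf x).
have [c cab E] := MVT_segment ab (fun x _ => fdf x) fc.
by exists c => //; move: cab; rewrite in_itv.
Qed.

Section TrigSum.
Variables (R : realType) (I : finType) (tau : I -> R).

Definition trig_sum (y : R) : R := \sum_i cos (tau i * y).

Definition cos_primitive (t y : R) : R := if t == 0 then y else sin (t * y) / t.

(** Integrals of [trig_sum] are handled as increments of this odd primitive, which is a distribution
    function as soon as [trig_sum] is nonnegative. *)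
Definition trig_primitive (y : R) : R := \sum_i cos_primitive (tau i) y.

(** After expansion of the cosine, the part multiplied by [sin (t * u)] is antisymmetric in [p] and
    [q] and sums to zero. *)
Lemma quadratic_form_cos (J : Type) (s : seq J) (b l : J -> R) (t u : R) :
  \sum_(p <- s) \sum_(q <- s) b p * b q * cos (t * (l p - l q + u)) =
  cos (t * u) * ((\sum_(p <- s) b p * cos (t * l p)) ^+ 2 +
                 (\sum_(p <- s) b p * sin (t * l p)) ^+ 2).
Proof.
set c := fun p => b p * cos (t * l p); set d := fun p => b p * sin (t * l p).
transitivity (\sum_(p <- s) \sum_(q <- s)
   (cos (t * u) * (c p * c q + d p * d q) -
    sin (t * u) * (d p * c q - c p * d q))).
  apply: eq_bigr => p _; apply: eq_bigr => q _.
  by rewrite !mulrDr mulrN cosD cosB sinB /c /d; ring.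
have dist f g : \sum_(p <- s) \sum_(q <- s) f p * g q =
    (\sum_(p <- s) f p) * (\sum_(p <- s) g p) :> R.
  by rewrite big_distrlr.
under eq_bigr => p _ do rewrite big_split sumrN -!mulr_sumr big_split sumrB /=.
rewrite big_split sumrN -!mulr_sumr big_split sumrB /= !dist.
by rewrite -/c -/d; ring.
Qed.

Lemma quadratic_form_trig_sum (J : Type) (s : seq J) (b l : J -> R) (u : R) :
  \sum_(p <- s) \sum_(q <- s) b p * b q * trig_sum (l p - l q + u) =
  \sum_i cos (tau i * u) * ((\sum_(p <- s) b p * cos (tau i * l p)) ^+ 2 +
                 (\sum_(p <- s) b p * sin (tau i * l p)) ^+ 2).
Proof.
under eq_bigr => p _ do
  (under eq_bigr => q _ do rewrite /trig_sum mulr_sumr; rewrite exchange_big /=).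
by rewrite exchange_big /=; apply: eq_bigr => i _; rewrite quadratic_form_cos.
Qed.

Lemma quadratic_form_trig_sum0 (J : Type) (s : seq J) (b l : J -> R) :
  \sum_(p <- s) \sum_(q <- s) b p * b q * trig_sum (l p - l q) =
  \sum_i ((\sum_(p <- s) b p * cos (tau i * l p)) ^+ 2 +
                 (\sum_(p <- s) b p * sin (tau i * l p)) ^+ 2).
Proof.
have := quadratic_form_trig_sum s b l 0.
under eq_bigr => p _ do under eq_bigr => q _ do rewrite addr0.
by move=> ->; apply: eq_bigr => i _; rewrite mulr0 cos0 mul1r.
Qed.

Definition pair_sum (s : seq nat) : R :=
  \sum_(m <- s) \sum_(n <- s) trig_sum (ln m%:R - ln n%:R).

Definition shifted_pair_sum (s : seq nat) (u : R) : R :=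
  \sum_(m <- s) \sum_(n <- s) trig_sum (ln m%:R - ln n%:R + u).

Lemma shifted_pair_sumE s u : shifted_pair_sum s u =
  \sum_i cos (tau i * u) * ((\sum_(n <- s) cos (tau i * ln n%:R)) ^+ 2 +
                 (\sum_(n <- s) sin (tau i * ln n%:R)) ^+ 2).
Proof.
have := quadratic_form_trig_sum s (fun=> 1) (fun n => ln n%:R) u.
under eq_bigr => p _ do under eq_bigr => q _ do rewrite !mul1r.
rewrite -/(shifted_pair_sum s u) => ->; apply: eq_bigr => i _.
by congr (_ * (_ ^+ 2 + _ ^+ 2)); apply: eq_bigr => n _; rewrite mul1r.
Qed.

Lemma pair_sumE s : pair_sum s =
  \sum_i ((\sum_(n <- s) cos (tau i * ln n%:R)) ^+ 2 +
          (\sum_(n <- s) sin (tau i * ln n%:R)) ^+ 2).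
Proof.
transitivity (shifted_pair_sum s 0).
  by apply: eq_bigr => m _; apply: eq_bigr => n _; rewrite addr0.
by rewrite shifted_pair_sumE; apply: eq_bigr => i _; rewrite mulr0 cos0 mul1r.
Qed.

Lemma pair_sum_ge0 s : 0 <= pair_sum s.
Proof. by rewrite pair_sumE; apply: sumr_ge0 => i _; rewrite addr_ge0 ?sqr_ge0. Qed.

(** In diagonal form the coefficients of the cosines are sums of squares, so [cos <= 1] shows that
    no shift increases the sum. The same form gives the converse bound, with loss [cos 1], for
    shifts with [|tau i * u| <= 1]. *)
Lemma shifted_pair_sum_le s u : shifted_pair_sum s u <= pair_sum s.
Proof.
rewrite shifted_pair_sumE pair_sumE; apply: ler_sum => i _.
by rewrite ler_piMl ?cos_le1 // addr_ge0 ?sqr_ge0.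
Qed.

Lemma le_cos1 (x : R) : `|x| <= 1 -> cos 1 <= cos x.
Proof.
move=> x1; rewrite -[cos x]cos_norm.
have pi2 := pi_ge2 R.
case: (ltrgtP `|x| 1) x1 => // [x1|->] // _.
by rewrite ltW // ltr_cos // in_itv /= ?normr_ge0 ?ler01 //=; lra.
Qed.

Lemma shifted_pair_sum_ge s u : (forall i, `|tau i * u| <= 1) ->
  cos 1 * pair_sum s <= shifted_pair_sum s u.
Proof.
move=> tu; rewrite shifted_pair_sumE pair_sumE mulr_sumr; apply: ler_sum => i _.
by rewrite ler_wpM2r ?addr_ge0 ?sqr_ge0 ?le_cos1.
Qed.

Lemma is_derive_cos_primitive (t y : R) :
  is_derive y 1 (cos_primitive t) (cos (t * y)).
Proof.
rewrite /cos_primitive; case: eqP => [->|/eqP t0].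
  by rewrite mul0r cos0; exact: is_derive_id.
have ty : is_derive y 1 ( *%R t) t.
  by have := is_deriveZ t (is_derive_id y 1); rewrite /GRing.scale /= mulr1.
have -> : (fun y => sin (t * y) / t) = t^-1 \*: (@sin R \o *%R t).
  by apply/funext => z /=; rewrite mulrC.
have st := @is_derive1_comp R (@sin R) ( *%R t) y _ _ (is_derive_sin (t * y)) ty.
have := is_deriveZ t^-1 st.
by rewrite /GRing.scale /= mulrCA mulVf ?mulr1.
Qed.

Lemma is_derive_bigsum (J : Type) (s : seq J) (f df : J -> R -> R) (y : R) :
  (forall i, is_derive y 1 (f i) (df i y)) ->
  is_derive y 1 (fun z => \sum_(i <- s) f i z) (\sum_(i <- s) df i y).
Proof.
move=> fd; have -> : (fun z => \sum_(i <- s) f i z) = \sum_(i <- s) f i.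
  by apply/funext => z; rewrite fct_sumE.
by elim/big_ind2 : _ => // [|*]; [exact: is_derive_cst|exact: is_deriveD].
Qed.

Lemma is_derive_trig_primitive (y : R) :
  is_derive y 1 trig_primitive (trig_sum y).
Proof.
apply: (@is_derive_bigsum _ _ (fun i => cos_primitive (tau i))
                          (fun i z => cos (tau i * z))) => i.
exact: is_derive_cos_primitive.
Qed.

Lemma trig_primitive_homo : (forall y, 0 <= trig_sum y) ->
  {homo trig_primitive : x y / x <= y}.
Proof.
move=> F0 x y xy; have [c _ E] := mean_value xy is_derive_trig_primitive.
by rewrite -subr_ge0 E mulr_ge0 // subr_ge0.
Qed.

Lemma continuous_trig_primitive : continuous trig_primitive.
Proof.
move=> x; apply: differentiable_continuous; apply/derivable1_diffP.
by case: (is_derive_trig_primitive x).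
Qed.

Definition shifted_primitive_sum (s : seq nat) (u : R) : R :=
  \sum_(m <- s) \sum_(n <- s) trig_primitive (ln m%:R - ln n%:R + u).

Lemma is_derive_shifted_primitive_sum s (u : R) :
  is_derive u 1 (shifted_primitive_sum s) (shifted_pair_sum s u).
Proof.
have one m n : is_derive u 1 (fun u => trig_primitive (ln m%:R - ln n%:R + u))
    (trig_sum (ln m%:R - ln n%:R + u)).
  set c := ln _ - ln _.
  have cu : is_derive u 1 (fun u => c + u) (0 + 1).
    exact: (is_deriveD (is_derive_cst c u 1) (is_derive_id u 1)).
  have := @is_derive1_comp R trig_primitive (fun u => c + u) u _ _
    (is_derive_trig_primitive (c + u)) cu.
  by rewrite add0r mulr1.
apply: (@is_derive_bigsum _ _
  (fun m u => \sum_(n <- s) trig_primitive (ln m%:R - ln n%:R + u))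
  (fun m u => \sum_(n <- s) trig_sum (ln m%:R - ln n%:R + u))) => m.
by apply: (@is_derive_bigsum _ _
  (fun n u => trig_primitive (ln m%:R - ln n%:R + u))
  (fun n u => trig_sum (ln m%:R - ln n%:R + u))).
Qed.

Lemma shifted_primitive_sum_le s (v w : R) : v <= w ->
  shifted_primitive_sum s w - shifted_primitive_sum s v <= (w - v) * pair_sum s.
Proof.
move=> vw; have [c _ ->] := mean_value vw (is_derive_shifted_primitive_sum s).
by rewrite mulrC ler_wpM2l ?subr_ge0 ?shifted_pair_sum_le.
Qed.

Lemma shifted_primitive_sum_ge s (u : R) : 0 <= u ->
  (forall i, `|tau i * u| <= 1) ->
  cos 1 * u * pair_sum s <=
  shifted_primitive_sum s u - shifted_primitive_sum s 0.
Proof.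
move=> u0 tu; have [c cu ->] := mean_value u0 (is_derive_shifted_primitive_sum s).
rewrite subr0 mulrAC ler_wpM2r // shifted_pair_sum_ge // => i.
apply: le_trans (tu i); rewrite !normrM ler_wpM2l //.
by rewrite !ger0_norm //; lra.
Qed.

(** Up to normalization this is the Fejer kernel as a function of the frequency [t], obtained by
    integrating [cos (t * y)] twice from 0. *)
Definition cos_primitive2 (t y : R) : R :=
  if t == 0 then y ^+ 2 / 2 else (1 - cos (t * y)) / t ^+ 2.

Lemma is_derive_cos_primitive2 (t y : R) :
  is_derive y 1 (cos_primitive2 t) (cos_primitive t y).
Proof.
rewrite /cos_primitive2 /cos_primitive; case: eqP => [_|/eqP t0].
  have -> : (fun y => y ^+ 2 / 2) = 2^-1 \*: ((@id R) ^+ 2).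
    by apply/funext => z /=; rewrite mulrC.
  have := is_deriveZ 2^-1 (is_deriveX 2 (is_derive_id y 1)).
  by rewrite /GRing.scale /= mulr1 expr1 mulrA mulVf ?mul1r.
have ty : is_derive y 1 ( *%R t) t.
  by have := is_deriveZ t (is_derive_id y 1); rewrite /GRing.scale /= mulr1.
have -> : (fun y => (1 - cos (t * y)) / t ^+ 2) =
    (t ^+ 2)^-1 \*: (cst 1 - (@cos R \o *%R t)).
  by apply/funext => z /=; rewrite mulrC.
have st := @is_derive1_comp R (@cos R) ( *%R t) y _ _ (is_derive_cos (t * y)) ty.
have := is_deriveZ (t ^+ 2)^-1 (is_deriveB (is_derive_cst (1 : R) y 1) st).
rewrite /GRing.scale /=; congr (is_derive _ _ _ _).
by field.
Qed.

Lemma sin_le_norm (x : R) : `|sin x| <= `|x|.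
Proof.
wlog x0 : x / 0 <= x => [H|].
  have [/H//|/ltW x0] := leP 0 x.
  by rewrite -normrN -sinN -[leRHS]normrN H // oppr_ge0.
have [c _] := mean_value x0 (@is_derive_sin R).
rewrite sin0 !subr0 => ->.
by rewrite normrM ler_piMl // cos_max.
Qed.

(** After multiplication by [1 + t ^+ 2], the two summands are bounded separately: the first by
    [|sin x| <= |x|], the second by [1 - cos <= 2]. *)
Lemma cos_primitive2_bound (t y : R) :
  0 <= cos_primitive2 t y <= (y ^+ 2 / 2 + 2) / (1 + t ^+ 2).
Proof.
have t1 : 0 < 1 + t ^+ 2 by rewrite ltr_wpDr ?sqr_ge0.
rewrite /cos_primitive2; case: eqP => [->|/eqP t0].
  by rewrite expr0n addr0 divr1; apply/andP; split; have := sqr_ge0 y; lra.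
have t2 : 0 < t ^+ 2 by rewrite exprn_even_gt0 //= t0.
have c1 := cos_le1 (t * y).
rewrite divr_ge0 ?(ltW t2) ?subr_ge0 //=.
rewrite ler_pdivlMr // mulrAC ler_pdivrMr //.
have E : 1 - cos (t * y) = 2 * sin (t * y / 2) ^+ 2.
  have {1}-> : t * y = (t * y / 2) *+ 2 by rewrite -mulr_natr; field.
  by rewrite cos_mulr2n sin2cos2; ring.
have S : sin (t * y / 2) ^+ 2 <= (t * y / 2) ^+ 2.
  by rewrite -[leLHS]real_normK ?num_real // -[leRHS]real_normK ?num_real //
     ler_sqr ?nnegrE // sin_le_norm.
have c2 := cos_geN1 (t * y).
have E2 : y ^+ 2 / 2 * t ^+ 2 = 2 * (t * y / 2) ^+ 2 by field.
have S2 : (1 - cos (t * y)) * t ^+ 2 <= 2 * t ^+ 2.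
  by rewrite ler_wpM2r ?sqr_ge0 //; lra.
rewrite (mulrDr _ 1) mulr1 (mulrDl _ 2) E2.
by apply: lerD => //; lra.
Qed.

Lemma trig_primitiveN y : trig_primitive (- y) = - trig_primitive y.
Proof.
rewrite /trig_primitive -sumrN; apply: eq_bigr => i _.
by rewrite /cos_primitive mulrN sinN mulNr; case: ifP.
Qed.

(* The integral of [trig_sum] over [-l, l] is bounded by its integral against a
   triangular weight, i.e. by the decaying Fejer kernel at the frequencies. *)
Lemma trig_primitive_le (l : R) : (forall y, 0 <= trig_sum y) -> 0 < l ->
  trig_primitive l - trig_primitive (- l) <=
  2 * (2 * l ^+ 2 + 2) / l * \sum_i (1 + tau i ^+ 2)^-1.
Proof.
move=> F0 l0.
pose phi y := \sum_i cos_primitive2 (tau i) y.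
have dphi (y : R) : is_derive y 1 phi (trig_primitive y).
  apply: (@is_derive_bigsum _ _ (fun i => cos_primitive2 (tau i))
                          (fun i z => cos_primitive (tau i) z)) => i.
  exact: is_derive_cos_primitive2.
have [|c /andP[lc _] E] := mean_value _ dphi (a := l) (b := 2 * l); first lra.
have phi0 y : 0 <= phi y.
  by apply: sumr_ge0 => i _; case/andP: (cos_primitive2_bound (tau i) y).
have phi1 : phi (2 * l) <= (2 * l ^+ 2 + 2) * \sum_i (1 + tau i ^+ 2)^-1.
  rewrite mulr_sumr; apply: ler_sum => i _.
  case/andP: (cos_primitive2_bound (tau i) (2 * l)) => _.
  by have -> : (2 * l) ^+ 2 / 2 = 2 * l ^+ 2 by field.
(* As [trig_primitive] is monotone, its mean over [l, 2 l] is at least its value at [l]. *)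
have mono := trig_primitive_homo F0 lc.
have step : trig_primitive l * l <= phi (2 * l).
  apply: (@le_trans _ _ (phi (2 * l) - phi l)); last by have := phi0 l; lra.
  by rewrite E (_ : 2 * l - l = l) ?ler_wpM2r ?(ltW l0) //; ring.
have : trig_primitive l <= (2 * l ^+ 2 + 2) / l * \sum_i (1 + tau i ^+ 2)^-1.
  by rewrite mulrAC ler_pdivlMr // (le_trans step).
by rewrite trig_primitiveN -!mulrA; lra.
Qed.

End TrigSum.

(** * Comparing increments of a monotone function over covering families *)

(** With [f] a primitive of [trig_sum], this turns a bound, at each point, for the number of windows
    containing it into a bound for sums of integrals over the windows. *)
Lemma stieltjes_cover (R : realType) (f : R -> R) (J1 J2 : Type)
    (s1 : seq J1) (s2 : seq J2) (a b : J1 -> R) (c d w : J2 -> R) :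
  {homo f : x y / x <= y} -> continuous f ->
  (forall j, a j <= b j) -> (forall j, c j <= d j) -> (forall j, 0 <= w j) ->
  (forall y, \sum_(j <- s1) (a j < y <= b j)%R%:R <=
             \sum_(j <- s2) w j * (c j < y <= d j)%R%:R) ->
  \sum_(j <- s1) (f (b j) - f (a j)) <=
  \sum_(j <- s2) w j * (f (d j) - f (c j)).
Proof.
move=> fm fc ab cd w0 le_ind.
(* Integrate [le_ind] against the Lebesgue-Stieltjes measure of [f]. *)
pose g : cumulative R R := HB.pack f
  (isCumulative.Build R _ R f fm (right_continuousW fc)).
pose mu := lebesgue_stieltjes_measure g.
have muE (x y : R) : x <= y -> mu `]x, y]%classic = (f y - f x)%:E.
  move=> xy; rewrite /mu /lebesgue_stieltjes_measure /measure_extension.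
  rewrite measurable_mu_extE; last exact: is_ocitv.
  exact: (wlength_itv_bnd g false false xy).
have indE (x y z : R) : (x < z <= y)%R%:R = \1_(`]x, y]%classic) z :> R.
  by rewrite indicE mem_setE in_itv.
have indm (v x y : R) (A : set R) : measurable_fun A
    (fun z : R => v * (x < z <= y)%R%:R : R).
  apply: measurable_funM => //; under eq_fun do rewrite indE.
  exact: measurable_indic.
have summ (J : Type) (s : seq J) (v x y : J -> R) : measurable_fun [set: R]
    (fun z => (\sum_(j <- s) v j * (x j < z <= y j)%R%:R)%:E).
  by apply/measurable_EFinP; apply: measurable_sum => j; exact: indm.
have intE (J : Type) (s : seq J) (v x y : J -> R) :
    (forall j, x j <= y j) -> (forall j, 0 <= v j) ->
    (\int[mu]_z (\sum_(j <- s) v j * (x j < z <= y j)%R%:R)%:E)%E =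
    (\sum_(j <- s) v j * (f (y j) - f (x j)))%:E.
  move=> xy v0; under eq_integral => z _ do rewrite -sumEFin.
  rewrite ge0_integral_sum //=; last first.
  - by move=> j z _; rewrite lee_fin mulr_ge0.
  - by move=> j; apply/measurable_EFinP; exact: indm.
  rewrite -sumEFin; apply: eq_bigr => j _.
  under eq_integral => z _ do rewrite indE EFinM.
  rewrite ge0_integralZl_EFin //; first by
    rewrite integral_indic // setIT [X in (_ * X)%E]muE.
  by apply/measurable_EFinP; exact: measurable_indic.
rewrite -lee_fin.
have -> : \sum_(j <- s1) (f (b j) - f (a j)) =
          \sum_(j <- s1) 1 * (f (b j) - f (a j)).
  by apply: eq_bigr => j _; rewrite mul1r.
rewrite -!intE //.
apply: ge0_le_integral => //.
- by move=> z _; rewrite lee_fin sumr_ge0 // => j _; rewrite mulr_ge0.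
- exact: summ.
- exact: summ.
- move=> z _; rewrite lee_fin; under eq_bigr do rewrite mul1r.
  exact: le_ind.
Qed.

(** * Lattice points in a strip and in the dual strip *)

Lemma size_le_fibers (T : eqType) (s : seq T) (V Z : nat) (f : T -> nat) :
  (forall p, p \in s -> (f p < V)%N) ->
  (forall v, (count (fun p => f p == v) s <= Z)%N) -> (size s <= V * Z)%N.
Proof.
case: V => [|V] fV fib.
  by case: s fV {fib} => // p s /(_ p (mem_head _ _)).
rewrite -sum1_size.
rewrite (eq_big_seq (fun p => \sum_(v < V.+1 | f p == v) 1)%N); last first.
  move=> p ps; rewrite (bigD1 (inord (f p))) /= ?inordK ?fV //.
  rewrite big1 ?addn0 // => v /andP[/eqP E].
  by rewrite E inord_val eqxx.
under eq_bigr => p _ do rewrite big_mkcond.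
rewrite exchange_big /=.
rewrite -[leqRHS]mulnC -[V.+1 in leqRHS]card_ord mulnC -sum_nat_const.
rewrite leq_sum // => v _.
by rewrite -big_mkcond /= sum1_count.
Qed.

Lemma size_le_diameter (t : seq nat) (z : nat) : uniq t ->
  {in t &, forall i j, i <= j + z}%N -> (size t <= z.+1)%N.
Proof.
move=> ut close; have [->//|t0] := eqVneq t [::].
have ex : exists i, i \in t.
  by case: t t0 {ut close} => // i t _; exists i; exact: mem_head.
case: (ex_minnP ex) => i it mini.
rewrite -(size_iota i z.+1); apply: uniq_leq_size => // j jt.
by rewrite mem_iota mini //= addnS ltnS close.
Qed.

(** As [a] and [q] are coprime, two points of one line differ by an integer multiple of [(a, q)];
    hence [p.2 %/ q] numbers the points injectively, with values at most [z] apart. *)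
Lemma size_le_line (s : seq (nat * nat)) (a q z : nat) (v : int) :
  (0 < q)%N -> coprime a q -> uniq s ->
  {in s, forall p, (p.2 * a)%N%:Z - (p.1 * q)%N%:Z = v} ->
  {in s &, forall p r j, p.1 = (r.1 + j * a)%N -> p.2 = (r.2 + j * q)%N ->
     (j <= z)%N} -> (size s <= z.+1)%N.
Proof.
move=> q0 aq us line gap.
have step (p r : nat * nat) : p \in s -> r \in s -> (r.2 <= p.2)%N ->
    exists j, p.1 = (r.1 + j * a)%N /\ p.2 = (r.2 + j * q)%N.
  move=> ps rs le_rp; have := line _ ps; rewrite -(line _ rs) => E.
  have := leq_mul le_rp (leqnn a) => le_a.
  have le1 : (r.1 * q <= p.1 * q)%N.
    move: E le_a; move: (r.1 * q)%N (p.1 * q)%N (p.2 * a)%N (r.2 * a)%N => x y w u.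
    by clear; lia.
  have {}le1 : (r.1 <= p.1)%N by rewrite -(leq_pmul2r q0); exact: le1.
  have E2 : ((p.2 - r.2) * a = (p.1 - r.1) * q)%N.
     rewrite !mulnBl.
    move: E le_a le1.
    move: (r.1 * q)%N (p.1 * q)%N (p.2 * a)%N (r.2 * a)%N => x y w u.
    by clear; lia.
  have : (q %| p.2 - r.2)%N.
    by rewrite -(@Gauss_dvdl _ _ a) 1?coprime_sym // E2 dvdn_mull.
  case/dvdnP=> j Ej; exists j; split; last by lia.
  by move: E2; rewrite Ej mulnAC => /eqP; rewrite eqn_pmul2r // => /eqP; lia.
rewrite -(size_map (fun p => p.2 %/ q)%N); apply: size_le_diameter.
  rewrite map_inj_in_uniq // => p r ps rs E.
  wlog le_rp : p r ps rs E / (r.2 <= p.2)%N.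
    by move=> W; case/orP: (leq_total r.2 p.2) => /W -> //; exact/esym.
  have [j [E1 E2]] := step _ _ ps rs le_rp.
  have j0 : j = 0%N by move: E; rewrite E2 divnDMl //; lia.
  by rewrite [p]surjective_pairing E1 E2 j0 !mul0n !addn0 -surjective_pairing.
move=> _ _ /mapP[p ps ->] /mapP[r rs ->].
case/orP: (leq_total r.2 p.2) => [le_rp|le_pr]; last first.
  by rewrite (leq_trans (leq_div2r _ le_pr)) // leq_addr.
have [j [E1 E2]] := step _ _ ps rs le_rp.
by rewrite E2 divnDMl // leq_add2l; exact: gap E1 E2.
Qed.

Section LatticeDuality.
Variables (R : realType) (x delta : R) (L B : nat) (s : seq nat).
Hypotheses (x0 : 0 <= x) (delta0 : 0 < delta) (L0 : (0 < L)%N).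
Hypothesis us : uniq s.
Hypothesis sL : forall n, n \in s -> (L <= n < 4 * L)%N.
Hypothesis HB : (Num.truncn (8 * delta)^-1)%:R * x + 1 <= B%:R.

(** [S] lists lattice points in a thin parallelogram along the line of slope [x], and [D] those in a
    rescaled polar parallelogram, the integer lattice being its own dual up to a rotation. By [HB]
    the cap [B] excludes no dual point. *)
Let S := [seq p <- allpairs pair s s | `|p.1%:R - p.2%:R * x| <= delta].
Let D := [seq p <- allpairs pair (iota 1 B) (iota 1 (Num.truncn (8 * delta)^-1))
         | `|p.1%:R - p.2%:R * x| <= (8 * L%:R)^-1].

(* [(a, q)] is a primitive lattice direction and [mu] the number of steps along it
   that stay within height [L] and error [delta].  The points of [S] lie on few
   lines of this direction, with O(mu) of them on each, while the multiples of
   [(a, q)] up to about mu / (8 delta L) belong to [D]. *)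
Section Direction.
Variables (a q : nat) (mu : R).
Hypotheses (a0 : (0 < a)%N) (q0 : (0 < q)%N) (aq : coprime a q).
Hypothesis qL : (q <= 4 * L)%N.
Hypothesis dir_err : `|a%:R - q%:R * x| <= delta.
Hypothesis mu4 : 1 / 4 <= mu.
Hypothesis mu_q : q%:R * mu <= L%:R.
Hypothesis mu_err : `|a%:R - q%:R * x| * mu <= delta.
Hypothesis mu_eq :
  q%:R * mu = L%:R \/ `|a%:R - q%:R * x| * mu = delta.

(** The multiples of [(a, q)] up to [J] are dual points: [mu_q] keeps their second coordinate below
    [(8 * delta)^-1], and [mu_err] keeps their error below [(8 * L)^-1]. *)
Lemma size_dual_ge : mu <= 8 * (delta * L%:R) * (1 + (size D)%:R).
Proof.
have [h1 h2 h3] := And3 mu4 mu_q mu_err.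
have L1 : 0 < L%:R :> R by rewrite ltr0n.
pose J := mu / (8 * (delta * L%:R)).
have mu0 : 0 <= mu by lra.
have J0 : 0 <= J by rewrite divr_ge0 // !mulr_ge0 // ltW.
have JD : (Num.truncn J <= size D)%N.
  pose t := [seq (j * a, j * q)%N | j <- iota 1 (Num.truncn J)].
  rewrite -[leqLHS](size_iota 1) -(size_map (fun j => (j * a, j * q)%N)).
  apply: uniq_leq_size.
    rewrite map_inj_uniq ?iota_uniq // => i j [/eqP].
    by rewrite eqn_pmul2r // => /eqP.
  move=> _ /mapP[j + ->]; rewrite mem_iota add1n ltnS => /andP[j0 jJ].
  have {}jJ : j%:R <= J by rewrite -truncn_ge_nat.
  have j1 : 0 < j%:R :> R by rewrite ltr0n.
  have jmu : 8 * (delta * L%:R) * j%:R <= mu.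
    by move: jJ; rewrite ler_pdivlMr 1?mulrC // !mulr_gt0.
  have jq : (j * q <= Num.truncn (8 * delta)^-1)%N.
    rewrite truncn_ge_nat ?invr_ge0 ?mulr_ge0 ?(ltW delta0) //.
    rewrite -[leRHS]mul1r ler_pdivlMr ?mulr_gt0 // natrM.
    have q1 : 0 < q%:R :> R by rewrite ltr0n.
    rewrite -(ler_pM2l L1).
    have := ler_wpM2l (ltW q1) jmu; lra.
  have jerr : `|(j * a)%:R - (j * q)%:R * x| <= (8 * L%:R)^-1.
    rewrite !natrM -mulrA -mulrBr normrM ger0_norm ?(ltW j1) //.
    rewrite -[leRHS]mul1r ler_pdivlMr ?mulr_gt0 //.
    rewrite -(ler_pM2l delta0).
    have := ler_wpM2l (normr_ge0 (a%:R - q%:R * x)) jmu; lra.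
  rewrite mem_filter /= jerr /=; apply/allpairsP.
  exists (j * a, j * q)%N; split => //=; rewrite mem_iota add1n ltnS muln_gt0.
    rewrite j0 a0 /= -(ler_nat R) (le_trans _ HB) //.
    have L8 : (8 * L%:R)^-1 <= 1 :> R.
      by rewrite invf_le1 ?mulr_gt0 // -natrM ler1n muln_gt0.
    have : (j * q)%:R * x <= (Num.truncn (8 * delta)^-1)%:R * x.
      by rewrite ler_wpM2r // ler_nat.
    have := le_trans (ler_norm _) jerr; lra.
  by rewrite j0 q0.
have : J < (Num.truncn J).+1%:R by exact: truncnS_gt.
have {}JD : (Num.truncn J).+1%:R <= 1 + (size D)%:R :> R.
  by rewrite -natr1 addrC lerD2l ler_nat.
move=> /lt_le_trans/(_ JD)/ltW.
by rewrite ler_pdivrMr ?mulr_gt0 // mulrC.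
Qed.

(** The integer [p.2 * a - p.1 * q] is at most [W] in absolute value on [S], which bounds the number
    of lines; each line carries at most [3 * mu + 1] points. *)
Lemma size_primal_le :
  (size S)%:R <= 46 * (delta * L%:R) + 7 * mu.
Proof.
have [h1 h2 h3] := And3 mu4 mu_q mu_err.
have L1 : 1 <= L%:R :> R by rewrite ler1n.
have q1 : 1 <= q%:R :> R by rewrite ler1n.
pose e := `|a%:R - q%:R * x|.
have e0 : 0 <= e by exact: normr_ge0.
pose W := 4 * L%:R * e + q%:R * delta.
have W0 : 0 <= W by rewrite addr_ge0 ?mulr_ge0 ?(ltW delta0) //; lra.
pose w := Num.truncn W; pose z := Num.truncn (3 * mu).
have inS p : p \in S ->
    [/\ (L <= p.1 < 4 * L)%N, (L <= p.2 < 4 * L)%N &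
        `|p.1%:R - p.2%:R * x| <= delta].
  rewrite mem_filter => /andP[err /allpairsP[[m n] /= [ms ns E]]].
  by rewrite E /= !sL //; split=> //; rewrite E in err.
have line p : p \in S -> `|(p.2 * a)%N%:Z - (p.1 * q)%N%:Z| <= w%:Z.
  case/inS => _ /andP[_ p2] err.
  have : `|(p.2 * a)%N%:R - (p.1 * q)%N%:R| <= W.
    have -> : (p.2 * a)%N%:R - (p.1 * q)%N%:R =
       p.2%:R * (a%:R - q%:R * x) - q%:R * (p.1%:R - p.2%:R * x) :> R.
      by rewrite !natrM; ring.
    apply: le_trans (ler_normB _ _) _; rewrite !normrM !normr_nat lerD //.
      by rewrite ler_wpM2r // -natrM ler_nat ltnW.
    by rewrite ler_wpM2l.
  set c : int := _ - _.
  have -> : (p.2 * a)%N%:R - (p.1 * q)%N%:R = c%:~R :> R by rewrite intrB.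
  rewrite -intr_norm -abszE => cW.
  by rewrite lez_nat truncn_ge_nat.
(* The index of a line is shifted by [w] to become a natural number; by [line] the subtraction is
   never truncated. *)
pose f (p : nat * nat) := (p.2 * a + w - p.1 * q)%N.
have szS : (size S <= (2 * w).+1 * z.+1)%N.
  apply: (@size_le_fibers _ _ _ _ f).
    move=> p /line; rewrite /f; move: (p.2 * a)%N (p.1 * q)%N (w) => y1 y2 y3.
    by clear; lia.
  move=> v; rewrite -size_filter.
  apply: (@size_le_line _ a q z (v%:Z - w%:Z)) => //.
  - rewrite filter_uniq // filter_uniq // allpairs_uniq //.
    by move=> [? ?] [? ?].
  - move=> p; rewrite mem_filter => /andP[/eqP <- /line]; rewrite /f.
    by move: (p.2 * a)%N (p.1 * q)%N (w) => y1 y2 y3; clear; lia.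
  move=> p r; rewrite mem_filter => /andP[_ /inS[p1 p2 perr]].
  rewrite mem_filter => /andP[_ /inS[r1 r2 rerr]] j E1 E2.
  have jq : (j * q <= 3 * L)%N.
    by move: p2 r2; rewrite E2; move: (j * q)%N (r.2) (L) => y1 y2 y3; clear; lia.
  have je : j%:R * e <= 2 * delta.
    have -> : j%:R * e = `|(p.1%:R - p.2%:R * x) - (r.1%:R - r.2%:R * x)|.
      rewrite E1 E2 !natrD !natrM.
      rewrite (_ : _ - _ - _ = j%:R * (a%:R - q%:R * x)); last by ring.
      by rewrite normrM normr_nat.
    by apply: le_trans (ler_normB _ _) _; lra.
  rewrite truncn_ge_nat; last by lra.
  (* Whichever constraint on [mu] is sharp bounds [j]: [j * q <= 3 * L] gives [j <= 3 * mu], and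
     [j * e <= 2 * delta] gives [j <= 2 * mu]. *)
  case: mu_eq => [E|E].
    have : (j * q)%:R <= (3 * L)%:R :> R by rewrite ler_nat.
    rewrite !natrM -E; nra.
  move: je; rewrite -E -/e => je.
  have epos : 0 < e by rewrite lt_neqAle e0 andbT; apply/eqP => e00;
    move: E delta0; rewrite -/e -e00 mul0r => <-; rewrite ltxx.
  by rewrite -(ler_pM2r epos); nra.
have wW : w%:R <= W by rewrite /w truncn_le.
have zm : z%:R <= 3 * mu by rewrite /z truncn_le; lra.
apply: (@le_trans _ _ ((2 * w).+1 * z.+1)%:R); first by rewrite ler_nat.
rewrite natrM -!natr1 natrM.
apply: (@le_trans _ _ ((2 * W + 1) * (3 * mu + 1))).
  by rewrite ler_pM // ?lerD2r ?ler_wpM2l.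
(* The product expands to 6 W mu + 2 W + 3 mu + 1; since 1 <= 4 mu, the next two bounds yield the
   constants 46 and 7. *)
have Wm : W * mu <= 5 * (delta * L%:R).
  have : L%:R * (e * mu) <= L%:R * delta by rewrite ler_wpM2l //; lra.
  have : delta * (q%:R * mu) <= delta * L%:R by rewrite ler_wpM2l // ltW.
  by rewrite /W; nra.
have W8 : W <= 8 * (delta * L%:R).
  have : L%:R * e <= L%:R * delta by rewrite ler_wpM2l //; lra.
  have : delta * q%:R <= delta * (4 * L%:R).
    by rewrite ler_wpM2l ?(ltW delta0) // -natrM ler_nat.
  by rewrite /W; nra.
nra.
Qed.

End Direction.

(** Eliminating [mu] between [size_primal_le] and [size_dual_ge] gives the constant 102 = 46 + 7 *
    8. *)
Lemma lattice_duality :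
  (size S)%:R <= 102 * (delta * L%:R) * (1 + (size D)%:R).
Proof.
have L1 : 1 <= L%:R :> R by rewrite ler1n.
have [->|/eqP] := eqVneq S [::].
  by rewrite /= !mulr_ge0 // ?(ltW delta0) // addr_ge0.
case ES : S => [//|[m0 n0] S'] _; rewrite -ES.
have : (m0, n0) \in S by rewrite ES mem_head.
rewrite mem_filter => /andP[/= err /allpairsP[[m n] /= [ms ns [E1 E2]]]].
rewrite -E1 in ms; rewrite -E2 in ns => {E1 E2 m n}.
have /andP[m1 m2] := sL ms; have /andP[n1 n2] := sL ns.
(* Any point of [S] divided by its gcd can serve as the direction. *)
pose g := gcdn m0 n0.
have g0 : (0 < g)%N by rewrite gcdn_gt0 (leq_trans L0).
pose a := (m0 %/ g)%N; pose q := (n0 %/ g)%N.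
have Em : m0 = (a * g)%N by rewrite divnK ?dvdn_gcdl.
have En : n0 = (q * g)%N by rewrite divnK ?dvdn_gcdr.
have a0 : (0 < a)%N by rewrite divn_gt0 // dvdn_leq ?dvdn_gcdl // (leq_trans L0).
have q0 : (0 < q)%N by rewrite divn_gt0 // dvdn_leq ?dvdn_gcdr // (leq_trans L0).
have aq : coprime a q.
  by rewrite /coprime -(eqn_pmul2r g0) muln_gcdl -Em -En mul1n.
have qL : (q <= 4 * L)%N by rewrite (leq_trans _ (ltnW n2)) // En leq_pmulr.
have g1 : 1 <= g%:R :> R by rewrite ler1n.
have aerr : `|a%:R - q%:R * x| <= delta.
  apply: le_trans err; rewrite Em En !natrM.
  rewrite (_ : _ * g%:R - _ = (a%:R - q%:R * x) * g%:R); last by ring.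
  by rewrite normrM normr_nat ler_peMr.
have q1 : 0 < q%:R :> R by rewrite ltr0n.
have qL1 : q%:R <= 4 * L%:R :> R by rewrite -natrM ler_nat.
(* [mu] is the smaller of L / q and delta / e, the latter read as infinite when e = 0. It is at
   least 1/4 because q <= 4 L and e <= delta. *)
have scale (e : R) : 0 <= e -> e <= delta -> exists mu : R, [/\ 1 / 4 <= mu,
    q%:R * mu <= L%:R, e * mu <= delta & q%:R * mu = L%:R \/ e * mu = delta].
  move=> e_ge0 e_le; have [le_eq|lt_eq] := leP (e * L%:R) (q%:R * delta).
    exists (L%:R / q%:R); rewrite ler_pdivlMr //; split; first lra.
    - by rewrite mulrC divfK ?gt_eqF.
    - by rewrite mulrA ler_pdivrMr // (mulrC delta).
    - by left; rewrite mulrC divfK ?gt_eqF.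
  have e0 : 0 < e.
    rewrite lt_neqAle e_ge0 andbT; apply/eqP => e0.
    by move: lt_eq; rewrite -e0 mul0r ltNge mulr_ge0 ?(ltW delta0) // ltW.
  exists (delta / e); rewrite ler_pdivlMr //; split; first lra.
  - by rewrite mulrA ler_pdivrMr // (mulrC L%:R) ltW.
  - by rewrite mulrC divfK ?gt_eqF.
  - by right; rewrite mulrC divfK ?gt_eqF.
have [mu [mu4 mu_q mu_e mu_eq]] := scale _ (normr_ge0 _) aerr.
have := size_primal_le q0 aq qL aerr mu4 mu_q mu_e mu_eq.
have := size_dual_ge a0 q0 mu4 mu_q mu_e.
have : 0 <= delta * L%:R * (size D)%:R by rewrite !mulr_ge0 // ltW.
have : 0 <= delta * L%:R by rewrite mulr_ge0 // ltW.
by set d := delta * _; set n := (size D)%:R; lra.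
Qed.

End LatticeDuality.

(** * Reflection *)

Lemma expR_le1D2x (R : realType) (u : R) : 0 <= u <= 1 / 2 -> expR u <= 1 + 2 * u.
Proof.
move=> /andP[u0 u2]; have e0 := expR_gt0 u.
have := expR_ge1Dx (- u); rewrite expRN => e1.
have : (1 - u) * expR u <= 1 by rewrite -ler_pdivlMr // mul1r.
by nra.
Qed.

Lemma ln_le_subr1 (R : realType) (x : R) : 0 < x -> ln x <= x - 1.
Proof.
move=> x0; have := @le_ln1Dx R (x - 1); rewrite (addrC 1) subrK; apply.
by rewrite ltrBrDr addNr.
Qed.

(** Exponentiating the window puts n e^y - m between 0 and 2 u m, with m <= 4 L. The range of [y]
    follows crudely from ln x <= x - 1. *)
Lemma primal_near (R : realType) (m n L : nat) (u y : R) :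
  0 <= u <= 1 / 2 -> (0 < L)%N -> (L <= m < 4 * L)%N -> (L <= n < 4 * L)%N ->
  ln m%:R - ln n%:R < y <= ln m%:R - ln n%:R + u ->
  [/\ 1 / 4 <= expR y, expR y <= 8, -7 < y <= 7 &
    `|m%:R - n%:R * expR y| <= 8 * L%:R * u].
Proof.
move=> u01 L0 /andP[m1 m2] /andP[n1 n2] /andP[y1 y2].
have u02 := expR_le1D2x u01; case/andP: u01 => u0 u1.
have m0 : 0 < m%:R :> R by rewrite ltr0n (leq_trans L0).
have n0 : 0 < n%:R :> R by rewrite ltr0n (leq_trans L0).
have LR0 : 0 < L%:R :> R by rewrite ltr0n.
have mL : m%:R <= 4 * L%:R :> R by rewrite -natrM ler_nat ltnW.
have nL : n%:R <= 4 * L%:R :> R by rewrite -natrM ler_nat ltnW.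
have Lm : L%:R <= m%:R :> R by rewrite ler_nat.
have Ln : L%:R <= n%:R :> R by rewrite ler_nat.
have E : expR (ln m%:R - ln n%:R) = m%:R / n%:R :> R.
  by rewrite expRB !lnK ?posrE.
have x1 : m%:R / n%:R < expR y by rewrite -E ltr_expR.
have x2 : expR y <= m%:R / n%:R * (1 + 2 * u).
  apply: (@le_trans _ _ (m%:R / n%:R * expR u)).
    by rewrite -E -expRD ler_expR.
  by rewrite ler_wpM2l ?divr_ge0 // ltW.
have x14 : 1 / 4 <= expR y.
  by apply: le_trans (ltW x1); rewrite ler_pdivlMr //; lra.
have m4n : m%:R / n%:R <= 4 :> R by rewrite ler_pdivrMr //; lra.
have mn0 : 0 <= m%:R / n%:R :> R by rewrite divr_ge0 // ltW.
have x8 : expR y <= 8 by nra.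
have nx1 : m%:R < n%:R * expR y by move: x1; rewrite ltr_pdivrMr // mulrC.
have nx2 : n%:R * expR y <= m%:R * (1 + 2 * u).
  by move: x2; rewrite mulrAC ler_pdivlMr // mulrC.
have lnx : y = ln (expR y) by rewrite expRK.
split => //.
  rewrite {2}lnx; apply/andP; split.
    have : - ln (expR y) <= 3; last by rewrite -lnx; lra.
    rewrite -lnV ?posrE ?expR_gt0 //.
    have : (expR y)^-1 <= 4.
      by rewrite invf_ple ?posrE ?expR_gt0 // (le_trans _ x14) //; lra.
    have : 0 < (expR y)^-1 by rewrite invr_gt0 expR_gt0.
    by move/ln_le_subr1; lra.
  by have := ln_le_subr1 (expR_gt0 y); lra.
rewrite ltr0_norm ?subr_lt0 // opprB; nra.
Qed.

(** The converse passage, from a small linear form back to a window: the logarithm of [z], the ratio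
    of l to h e^y, is estimated by ln z <= z - 1 and its analogue for the inverse of z. *)
Lemma dual_near (R : realType) (l h : nat) (eta y : R) :
  (0 < h)%N -> 0 < eta <= 1 / 8 -> 1 / 4 <= expR y -> expR y <= 8 ->
  `|l%:R - h%:R * expR y| <= eta ->
  (l <= 9 * h)%N /\
  ln l%:R - ln h%:R - 8 * eta / h%:R < y <= ln l%:R - ln h%:R + 8 * eta / h%:R.
Proof.
move=> h0 /andP[e0 e8] x1 x2 /ler_normlP [err1 err2].
have h1 : 1 <= h%:R :> R by rewrite ler1n.
split.
  rewrite -(ler_nat R) natrM; nra.
have l0 : 0 < l%:R :> R by nra.
have hR0 : 0 < h%:R :> R by lra.
have hx0 : 0 < h%:R * expR y by rewrite mulr_gt0 // expR_gt0.
(* Since e^y >= 1/4, the ratio [z] differs from 1 by at most [v]. The doubled width accounts for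
   inverting [z] and leaves the strict inequality on the left. *)
pose v := 4 * eta / h%:R.
have -> : 8 * eta / h%:R = 2 * v by rewrite /v; ring.
have v0 : 0 < v by rewrite divr_gt0 // mulr_gt0.
have v2 : v <= 1 / 2 by rewrite ler_pdivrMr //; lra.
have vh : v * h%:R = 4 * eta by rewrite /v divfK // gt_eqF.
pose z := l%:R / (h%:R * expR y).
have z0 : 0 < z by rewrite divr_gt0.
have lnz : ln z = ln l%:R - ln h%:R - y.
  by rewrite ln_div ?posrE // lnM ?posrE ?expR_gt0 // expRK; ring.
have zhx : z * (h%:R * expR y) = l%:R by rewrite /z divfK // gt_eqF.
have z1 : z - 1 <= v.
  rewrite lerBlDr ler_pdivrMr //; nra.
have z2 : 1 - v <= z.
  rewrite ler_pdivlMr //; nra.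
have ln1 := ln_le_subr1 z0.
have ln2 : - ln z <= z^-1 - 1.
  by rewrite -lnV ?posrE // ln_le_subr1 // invr_gt0.
have z3 : z^-1 - 1 <= 2 * v.
  rewrite lerBlDr -[z^-1]mul1r ler_pdivrMr //; nra.
by apply/andP; split; lra.
Qed.

Lemma size_filter_allpairs (R : realType) (T : eqType) (s t : seq T)
    (c : pred (T * T)) :
  (size [seq p <- allpairs pair s t | c p])%:R =
  \sum_(m <- s) \sum_(n <- t) (c (m, n))%:R :> R.
Proof.
rewrite size_filter -sum1_count big_mkcond natr_sum big_allpairs.
by apply: eq_bigr => m _; apply: eq_bigr => n _; case: (c _).
Qed.

Section Reflection.
Variables (R : realType) (I : finType) (tau : I -> R).

(** This is the quantity G(K) of the opening comment, with F = [trig_sum tau]. *)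
Definition weighted_pair_sum (K : nat) : R :=
  \sum_(m <- iota 1 K) \sum_(n <- iota 1 K)
    (Num.sqrt m%:R)^-1 * (Num.sqrt n%:R)^-1 * trig_sum tau (ln m%:R - ln n%:R).

Hypothesis F0 : forall y, 0 <= trig_sum tau y.

Lemma weighted_pair_sum_ge0 K : 0 <= weighted_pair_sum K.
Proof.
apply: sumr_ge0 => m _; apply: sumr_ge0 => n _.
by rewrite !mulr_ge0 ?invr_ge0 ?sqrtr_ge0.
Qed.

Lemma weighted_pair_sum_le K K' : (K <= K')%N ->
  weighted_pair_sum K <= weighted_pair_sum K'.
Proof.
move=> /subnKC <-; rewrite /weighted_pair_sum iotaD big_cat /=.
rewrite ler_wpDr //.
  apply: sumr_ge0 => m _; apply: sumr_ge0 => n _.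
  by rewrite !mulr_ge0 ?invr_ge0 ?sqrtr_ge0.
apply: ler_sum => m _; rewrite big_cat /= ler_wpDr //.
by apply: sumr_ge0 => n _; rewrite !mulr_ge0 ?invr_ge0 ?sqrtr_ge0.
Qed.

Lemma pair_sum_le_weighted K :
  pair_sum tau (iota 1 K) <= K%:R * weighted_pair_sum K.
Proof.
rewrite /pair_sum mulr_sumr !big_seq; apply: ler_sum => m; rewrite mem_iota => mK.
rewrite mulr_sumr !big_seq; apply: ler_sum => n; rewrite mem_iota => nK.
rewrite mulrA ler_peMl //.
have sq (j : nat) : (1 <= j < 1 + K)%N ->
    0 < Num.sqrt j%:R :> R /\ Num.sqrt j%:R <= Num.sqrt K%:R :> R.
  case/andP=> j1 jK; rewrite sqrtr_gt0 ltr0n j1; split => //.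
  by rewrite ler_sqrt // ler_nat -ltnS.
have [m0 m1] := sq _ mK; have [n0 n1] := sq _ nK.
rewrite -invfM ler_pdivlMr ?mulr_gt0 // mul1r.
rewrite -[leRHS]sqr_sqrtr // expr2.
by rewrite ler_pM // ltW.
Qed.

Variables (Theta : R) (L : nat).
Hypotheses (Theta1 : 1 <= Theta) (tauT : forall i, `|tau i| <= Theta).
Hypothesis L0 : (0 < L)%N.

(** [delta] is the error in [primal_near], and [H] the largest denominator of a dual point. The [J]
    dyadic blocks cover all denominators up to [H]. In block [i], [dual_near] with eta = 1 / (8 L)
    gives l <= 9 h < [K i] and windows of radius 1 / (L h) <= [rho i]. *)
Let u : R := (2 * Theta)^-1.
Let delta : R := 8 * L%:R * u.
Let H := Num.truncn (8 * delta)^-1.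
Let J := up_log 2 H.+1.
Let K (i : nat) := (18 * 2 ^ i)%N.
Let s := iota L (3 * L).
Let rho (i : nat) : R := (2 ^ i * L)%:R^-1.
Let window := (R * R)%type.
Let primal (p : nat * nat) : window :=
  (ln p.1%:R - ln p.2%:R, ln p.1%:R - ln p.2%:R + u).
(** [Some (i, p)] serves a dual point [p] with denominator in block [i]. [None] stands for the term
    1 in [lattice_duality]; its window contains every primal window over [s]. *)
Let dual (j : option (nat * (nat * nat))) : window :=
  if j is Some (i, p) then
    (ln p.1%:R - ln p.2%:R - rho i, ln p.1%:R - ln p.2%:R + rho i)
  else (-7, 7).
Let s1 := allpairs pair s s.
Let s2 := None :: [seq Some (i, p) | i <- iota 0 J,
                     p <- allpairs pair (iota 1 (K i)) (iota 1 (K i))].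

Let u01 : 0 <= u <= 1 / 2.
Proof.
rewrite /u invr_ge0 mulr_ge0 ?(le_trans _ Theta1) //= invfM.
by rewrite mul1r ler_piMr ?invr_ge0 // invf_le1 ?(lt_le_trans _ Theta1).
Qed.

Let u_gt0 : 0 < u.
Proof. by rewrite invr_gt0 mulr_gt0 // (lt_le_trans _ Theta1). Qed.

Let delta0 : 0 < delta.
Proof. by rewrite !mulr_gt0 // ltr0n. Qed.

Let in_s n : n \in s -> (L <= n < 4 * L)%N.
Proof. by rewrite mem_iota -mulSn. Qed.

(** The primal windows containing [y] give lattice points near the line of slope e^y;
    [lattice_duality] bounds their number by that of the dual points, and [dual_near] returns these
    to windows containing [y]. *)
Lemma cover_pointwise (y : R) :
  \sum_(p <- s1) ((primal p).1 < y <= (primal p).2)%R%:R <=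
  \sum_(j <- s2) 102 * (delta * L%:R) * ((dual j).1 < y <= (dual j).2)%R%:R.
Proof.
have c0 : 0 <= 102 * (delta * L%:R) by rewrite !mulr_ge0 // ltW.
have [/hasP[p0 p0s near0]|] :=
  boolP (has (fun p => (primal p).1 < y <= (primal p).2) s1); last first.
  move=> /hasPn none; rewrite big_seq big1 => [|p /none /negbTE -> //].
  by apply: sumr_ge0 => j _; rewrite mulr_ge0.
case/allpairsP: p0s near0 => -[m0 n0] /= [ms ns ->] near0.
have [x1 x2 y7 _] := primal_near u01 L0 (in_s ms) (in_s ns) near0.
have x0 : 0 <= expR y by exact: expR_ge0.
pose B := (8 * H + 1)%N.
have HB : H%:R * expR y + 1 <= B%:R.
  by rewrite natrD lerD2r natrM mulrC ler_wpM2r.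
have := lattice_duality x0 delta0 L0 (iota_uniq _ _) in_s HB.
rewrite -/s -/H; set S := size _; set D := size _ => SD.
apply: (@le_trans _ _ S%:R).
  rewrite /S size_filter_allpairs big_allpairs big_seq [leRHS]big_seq.
  apply: ler_sum => m {}ms; rewrite big_seq [leRHS]big_seq.
  apply: ler_sum => n {}ns.
  case: (boolP ((primal (m, n)).1 < y <= (primal (m, n)).2)) => // near.
  by have [_ _ _ ->] := primal_near u01 L0 (in_s ms) (in_s ns) near.
apply: (le_trans SD); rewrite -mulr_sumr ler_wpM2l //.
rewrite big_cons /= y7 lerD2l big_allpairs_dep /=.
pose ind (i : nat) (p : nat * nat) := ln p.1%:R - ln p.2%:R - rho i < y <=
   ln p.1%:R - ln p.2%:R + rho i.
apply: (@le_trans _ _ (\sum_(i <- iota 0 J)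
   size [seq p <- allpairs pair (iota 1 (K i)) (iota 1 (K i)) | ind i p])%:R);
  last first.
  rewrite natr_sum; apply: ler_sum => i _.
  by rewrite size_filter_allpairs big_allpairs.
rewrite ler_nat /D; set t := [seq p <- _ | _]. 
have in_t p : p \in t -> [/\ (0 < p.1)%N, (0 < p.2 <= H)%N, (p.1 <= 9 * p.2)%N &
    forall i, (2 ^ i <= p.2)%N -> ind i p].
  rewrite mem_filter => /andP[/= err /allpairsP[[l h] /= [ls hs Ep]]].
  move: err; rewrite {p}Ep /= => err.
  move: ls hs; rewrite !mem_iota => /andP[l0 _] /andP[h0 hH].
  have LR : 1 <= L%:R :> R by rewrite ler1n.
  have e01 : 0 < (8 * L%:R : R)^-1 <= 1 / 8.
    rewrite invr_gt0 mulr_gt0 ?(lt_le_trans _ LR) //= invfM mul1r.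
    by rewrite ler_piMr // invf_le1 // (lt_le_trans _ LR).
  have [l9 near] := dual_near h0 e01 x1 x2 err.
  split => //; first by rewrite h0.
  move=> i ih; rewrite /ind /=.
  have : 8 * (8 * L%:R)^-1 / h%:R <= rho i.
    rewrite invfM mulrA mulfV // mul1r -invfM -natrM lef_pV2 ?posrE ?ltr0n.
    - by rewrite ler_nat mulnC leq_pmul2l.
    - by rewrite muln_gt0 L0.
    - by rewrite muln_gt0 L0 expn_gt0.
  by case/andP: near => ? ?; lra.
(* Each dual point is assigned to the dyadic block of its denominator, so that it is counted in a
   box of side [K i]. *)
have -> : size t = (\sum_(i <- iota 0 J)
    size [seq p <- t | trunc_log 2 p.2 == i])%N.
  under eq_bigr do rewrite size_filter -sum1_count big_mkcond.
  rewrite exchange_big /= -sum1_size big_seq [RHS]big_seq.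
  apply: eq_bigr => p /in_t[_ /andP[h0 hH] _ _].
  rewrite (bigD1_seq (trunc_log 2 p.2)) ?iota_uniq //=.
    by rewrite eqxx big1 // => i /negPf; rewrite eq_sym => ->.
  rewrite mem_iota /= add0n.
  have : (2 ^ trunc_log 2 p.2 < 2 ^ J)%N.
    apply: leq_trans (up_logP _ _) => //.
    by rewrite ltnS (leq_trans (trunc_logP _ h0)).
  by rewrite ltn_exp2l.
rewrite big_seq [leqRHS]big_seq; apply: leq_sum => i _.
apply: uniq_leq_size.
  by rewrite !filter_uniq // allpairs_uniq ?iota_uniq // => -[? ?] [? ?].
move=> p; rewrite mem_filter => /andP[/eqP log_p /in_t[l0 /andP[h0 hH] l9 near]].
rewrite mem_filter near; last by rewrite -log_p trunc_logP.
have h2 : (p.2 < 2 ^ i.+1)%N by rewrite -log_p trunc_log_ltn.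
apply/allpairsP; exists p; rewrite -surjective_pairing !mem_iota l0 h0 /K.
rewrite expnS in h2; move: h2 l9; move: (p.1) (p.2) (2 ^ i)%N => y1 y2 y3.
by clear => ? ?; split => //; apply/andP; split => //; lia.
Qed.

(** [cover_pointwise] is integrated against [trig_sum]. On the left the windows have length [u],
    short enough to lose only [cos 1]. On the right [None] gives the energy term through
    [trig_primitive_le], and block [i] gives 2 rho(i) K(i) = 36 / L times a weighted sum. *)
Lemma reflection :
  cos 1 * pair_sum tau s / L%:R <=
  816 * (200 / 7 * (L%:R * \sum_i (1 + tau i ^+ 2)^-1) +
         36 * J%:R * weighted_pair_sum (18 * H)).
Proof.
have cF := continuous_trig_primitive (tau := tau).
have mF := trig_primitive_homo F0.
have rho0 i : 0 <= rho i by rewrite invr_ge0.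
have pp := cover_pointwise.
have primal_le p : (primal p).1 <= (primal p).2 by rewrite lerDl ltW.
have dual_le j : (dual j).1 <= (dual j).2.
  by case: j => [[i p]|] /=; [rewrite lerBlDr -addrA lerDl addr_ge0|lra].
have w0 : 0 <= 102 * (delta * L%:R) by rewrite !mulr_ge0 // ltW.
have := @stieltjes_cover R (trig_primitive tau) _ _ s1 s2 _ _ _ _ _
   mF cF primal_le dual_le (fun=> w0) pp.
have LR : 1 <= L%:R :> R by rewrite ler1n.
have LR0 : 0 < L%:R :> R by rewrite ltr0n.
set E := \sum_i _; set W := weighted_pair_sum _.
rewrite big_allpairs big_cons big_allpairs_dep /=.
have lower : cos 1 * u * pair_sum tau s <=
  \sum_(m <- s) \sum_(n <- s) (trig_primitive tau (ln m%:R - ln n%:R + u) -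
     trig_primitive tau (ln m%:R - ln n%:R)).
  have := @shifted_primitive_sum_ge R I tau s u (ltW u_gt0).
  have tu i : `|tau i * u| <= 1.
    have T1 := Theta1; have T0 : 0 < 2 * Theta by lra.
    rewrite normrM (ger0_norm (ltW u_gt0)) ler_pdivrMr // mul1r.
    by rewrite (le_trans (tauT i)) //; lra.
  move=> /(_ tu) /le_trans; apply; rewrite /shifted_primitive_sum.
  rewrite -sumrB ler_sum // => m _; rewrite -sumrB ler_sum // => n _.
  by rewrite addr0.
move=> /(le_trans lower).
have main := trig_primitive_le F0 (l := 7).
have dualb i : (i < J)%N ->
  \sum_(p <- allpairs pair (iota 1 (K i)) (iota 1 (K i)))
     (trig_primitive tau (ln p.1%:R - ln p.2%:R + rho i) -
      trig_primitive tau (ln p.1%:R - ln p.2%:R - rho i)) <= 36 / L%:R * W.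
  move=> iJ; rewrite big_allpairs /=.
  apply: (@le_trans _ _ ((rho i - - rho i) * pair_sum tau (iota 1 (K i)))).
    have nr : - rho i <= rho i by have := rho0 i; lra.
    apply: le_trans (shifted_primitive_sum_le tau (iota 1 (K i)) nr).
    rewrite /shifted_primitive_sum -sumrB ler_sum // => m _.
    by rewrite -sumrB ler_sum.
  (* Minimality of [J] makes every block start at or below [H], so all boxes lie within length 18
     H. *)
  have iH : (2 ^ i <= H)%N.
    by rewrite leqNgt; apply/negP => /(@up_log_min 2 _ _ isT); rewrite leqNgt iJ.
  have := pair_sum_le_weighted (K i).
  have KW : weighted_pair_sum (K i) <= W.
    by rewrite weighted_pair_sum_le // /K leq_mul2l iH.
  rewrite opprK -mulr2n => h1.
  apply: (@le_trans _ _ (rho i *+ 2 * ((K i)%:R * W))).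
    rewrite ler_wpM2l ?mulrn_wge0 // (le_trans h1) // ler_wpM2l //.
  rewrite /rho /K !natrM invfM -mulr_natl !mulrA.
  have i0 : (2 ^ i)%:R != 0 :> R by rewrite pnatr_eq0 expn_eq0.
  by rewrite le_eqVlt; apply/orP; left; apply/eqP; field; rewrite i0 gt_eqF.
have dual_total :
    \sum_(i <- iota 0 J)
     \sum_(p <- allpairs pair (iota 1 (K i)) (iota 1 (K i)))
     102 * (delta * L%:R) *
     (trig_primitive tau (ln p.1%:R - ln p.2%:R + rho i) -
      trig_primitive tau (ln p.1%:R - ln p.2%:R - rho i)) <=
    102 * (delta * L%:R) * (J%:R * (36 / L%:R * W)).
  have -> : J%:R * (36 / L%:R * W) = \sum_(i <- iota 0 J) 36 / L%:R * W.
    by rewrite big_const_seq count_predT size_iota iter_addr addr0 mulr_natl.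
  rewrite mulr_sumr big_seq [leRHS]big_seq ler_sum // => i; rewrite mem_iota => /= iJ.
  by rewrite -mulr_sumr ler_wpM2l ?dualb.
move=> total.
have {}main := main (ltr0Sn _ _).
have cover2 := le_trans total (lerD (ler_wpM2l w0 main) dual_total).
(* The factor [u] in [delta] cancels the window length on the left; 816 is 102 * 8. *)
have E1 : 102 * (delta * L%:R) = 816 * L%:R ^+ 2 * u by rewrite /delta; ring.
have C : 2 * (2 * 7 ^+ 2 + 2) / 7 = 200 / 7 :> R by field.
rewrite E1 C -mulrDr -/E in cover2.
rewrite ler_pdivrMr // -(ler_pM2r u_gt0).
rewrite (_ : _ * u = cos 1 * u * pair_sum tau s); last by ring.
apply: (le_trans cover2).
by rewrite le_eqVlt; apply/orP; left; apply/eqP; field; rewrite gt_eqF.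
Qed.
End Reflection.

(** * Divisors, common multiples and squaring *)

Lemma size_divisors (n : nat) :
  size (divisors n) = (\prod_(f <- prime_decomp n) f.2.+1)%N.
Proof.
rewrite /divisors; elim: (prime_decomp n) => [|[p e] s IH] /=.
  by rewrite big_nil.
rewrite big_cons -IH /=; set t := foldr _ _ _.
elim: e => [|e IHe] /=; first by rewrite mul1n.
by rewrite size_merge size_cat size_map IHe -mulSnr.
Qed.

(** With c the integer quotient of e by r, one has e + 1 <= r (c + 1) and c + 1 <= 2 ^ c. *)
Lemma succ_expn_le (r e : nat) : (0 < r)%N -> (e.+1 ^ r <= r ^ r * 2 ^ e)%N.
Proof.
move=> r0; apply: (@leq_trans ((r * 2 ^ (e %/ r)) ^ r)%N).
  rewrite leq_exp2r // (leq_trans (ltn_ceil e r0)) // mulnC leq_mul2l.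
  by rewrite ltn_expl ?orbT.
by rewrite expnMn leq_mul2l -expnM leq_exp2l // leq_divM orbT.
Qed.

(** The classical divisor bound, prime by prime: if p >= 2 ^ r then (e + 1) ^ r <= 2 ^ (e r) <= p ^
    e, and each of the fewer than 2 ^ r smaller primes costs a factor r ^ r. *)
Lemma size_divisors_expn_le (r : nat) : (0 < r)%N -> exists C : nat,
  forall n : nat, (0 < n)%N -> (size (divisors n) ^ r <= C * n)%N.
Proof.
move=> r0; pose c := (r ^ r)%N.
have c0 : (0 < c)%N by rewrite expn_gt0 r0.
exists (c ^ (2 ^ r))%N => n n0.
pose w p := if (p < 2 ^ r)%N then c else 1%N.
rewrite size_divisors {2}[n]prod_prime_decomp //.
have fact_le f : f \in prime_decomp n ->
    (f.2.+1 ^ r <= w f.1 * f.1 ^ f.2)%N.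
  case: f => p e /mem_prime_decomp[p_pr e0 _] /=; rewrite /w.
  have p2 := prime_gt1 p_pr.
  case: ifP => small.
    apply: leq_trans (succ_expn_le e r0) _.
    by rewrite leq_mul2l leq_exp2r ?p2 ?orbT.
  rewrite mul1n (@leq_trans ((2 ^ e) ^ r)%N) //.
    by rewrite leq_exp2r // ltn_expl.
  by rewrite -expnM mulnC expnM leq_exp2r // leqNgt small.
apply: (@leq_trans (\prod_(f <- prime_decomp n) (w f.1 * f.1 ^ f.2))%N).
  rewrite (big_morph (fun x => x ^ r)%N (fun x y => expnMn x y r) (exp1n r)).
  by rewrite big_seq [leqRHS]big_seq; apply: leq_prod.
rewrite big_split /= leq_mul //.
have -> : (\prod_(f <- prime_decomp n) w f.1 = \prod_(p <- primes n) w p)%N.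
  by rewrite /primes /unzip1 big_map.
rewrite /w -big_mkcond /= big_const_seq iter_muln muln1 leq_pexp2l //.
rewrite -size_filter -[leqRHS](size_iota 0); apply: uniq_leq_size.
  by rewrite filter_uniq // primes_uniq.
by move=> p; rewrite mem_filter mem_iota add0n leq0n => /andP[].
Qed.

Lemma size_divisors_le (R : realType) (eps : R) : 0 < eps -> exists2 C : R,
  1 <= C & forall n : nat, (0 < n)%N ->
    (size (divisors n))%:R <= C * n%:R `^ eps.
Proof.
move=> e0; pose r := (Num.truncn eps^-1).+1.
have [C HC] := @size_divisors_expn_le r (ltn0Sn _).
have r0 : 0 < r%:R :> R by rewrite ltr0n.
have re : r%:R^-1 <= eps.
  by rewrite -[eps]invrK lef_pV2 ?posrE ?invr_gt0 // ltW // truncnS_gt.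
exists (1 + C%:R `^ r%:R^-1); first by rewrite lerDl powR_ge0.
move=> n n0; have n1 : 1 <= n%:R :> R by rewrite ler1n.
have := HC n n0; rewrite -(ler_nat R) natrX natrM => le1.
have d0 : 0 <= (size (divisors n))%:R :> R by [].
have : ((size (divisors n))%:R ^+ r) `^ r%:R^-1 <= (C%:R * n%:R) `^ r%:R^-1 :> R.
  by rewrite ge0_ler_powR ?invr_ge0 ?nnegrE ?exprn_ge0 ?mulr_ge0.
rewrite -powR_mulrn // -powRrM mulfV ?gt_eqF // powRr1 // powRM // => /le_trans.
apply; rewrite mulrDl mul1r ler_wpDl ?powR_ge0 // ler_wpM2l ?powR_ge0 //.
by rewrite ler_powR.
Qed.

Lemma big_fiber_le (R : realType) (T T' : eqType) (s : seq T) (t : seq T')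
    (g : T -> T') (f : T' -> R) (d : R) : uniq t ->
  (forall x, x \in s -> g x \in t) -> (forall y, y \in t -> 0 <= f y) ->
  (forall y, y \in t -> (size [seq x <- s | g x == y])%:R <= d) ->
  \sum_(x <- s) f (g x) <= d * \sum_(y <- t) f y.
Proof.
move=> ut gt f0 fib.
have -> : \sum_(x <- s) f (g x) =
    \sum_(y <- t) (size [seq x <- s | g x == y])%:R * f y.
  have E y : (size [seq x <- s | g x == y])%:R * f y =
      \sum_(x <- s) if g x == y then f y else 0.
    by rewrite size_filter -big_mkcond /= big_const_seq iter_addr addr0 mulr_natl.
  under [RHS]eq_bigr => y _ do rewrite E.
  rewrite exchange_big /= big_seq [RHS]big_seq; apply: eq_bigr => x /gt gxt.
  rewrite (bigD1_seq (g x)) //= eqxx big1 ?addr0 // => y.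
  by rewrite eq_sym => /negPf ->.
rewrite mulr_sumr big_seq [leRHS]big_seq; apply: ler_sum => y yt.
by rewrite ler_wpM2r ?f0 ?fib.
Qed.

Lemma sqr_sum_le (R : realType) (J : Type) (s : seq J) (a : J -> R) :
  (\sum_(j <- s) a j) ^+ 2 <= (size s)%:R * \sum_(j <- s) a j ^+ 2.
Proof.
rewrite expr2 big_distrlr /=.
apply: (@le_trans _ _ (\sum_(i <- s) \sum_(j <- s) 2^-1 * (a i ^+ 2 + a j ^+ 2))).
  apply: ler_sum => i _; apply: ler_sum => j _.
  by have := sqr_ge0 (a i - a j); rewrite sqrrB; lra.
have sumc (c : R) : \sum_(j <- s) c = (size s)%:R * c.
  by rewrite big_const_seq count_predT iter_addr addr0 mulr_natl.
have inner i : \sum_(j <- s) 2^-1 * (a i ^+ 2 + a j ^+ 2) =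
    2^-1 * ((size s)%:R * a i ^+ 2 + \sum_(j <- s) a j ^+ 2).
  by rewrite -mulr_sumr big_split /= sumc.
rewrite (eq_bigr _ (fun i _ => inner i)).
by rewrite -mulr_sumr big_split /= sumc -mulr_sumr; lra.
Qed.

Section Divisors.
Variables (R : realType) (I : finType) (tau : I -> R).
Hypothesis F0 : forall y, 0 <= trig_sum tau y.

(** Multiplying [m] and [n] by a common [l] in [Q, 2 Q) preserves their ratio. A target pair
    determines its source once [l] is known, and [l] divides its first entry, so it arises at most
    [d] times. *)
Lemma pair_sum_multiples (V Q : nat) (d : R) : (0 < V)%N -> (0 < Q)%N ->
  (forall n, (0 < n < 4 * (Q * V))%N -> (size (divisors n))%:R <= d) ->
  Q%:R * pair_sum tau (iota V V) <= d * pair_sum tau (iota (Q * V) (3 * (Q * V))).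
Proof.
move=> V0 Q0 dd.
pose f (p : nat * nat) := trig_sum tau (ln p.1%:R - ln p.2%:R).
pose g (x : nat * (nat * nat)) := (x.1 * x.2.1, x.1 * x.2.2)%N.
pose s := allpairs pair (iota Q Q) (allpairs pair (iota V V) (iota V V)).
pose t := allpairs pair (iota (Q * V) (3 * (Q * V))) (iota (Q * V) (3 * (Q * V))).
have in_s x : x \in s -> [/\ (0 < x.1)%N, (0 < x.2.1)%N, (0 < x.2.2)%N & g x \in t].
  case/allpairsP => -[l p] /= [ls /allpairsP[[m n] /= [ms ns ->]] ->] /=.
  move: ls ms ns; rewrite !mem_iota => /andP[l1 l2] /andP[m1 m2] /andP[n1 n2].
  split; try exact: leq_trans _ l1; try exact: leq_trans _ m1;
    try exact: leq_trans _ n1.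
  have bnd j : (V <= j)%N -> (j < V + V)%N ->
      (l * j \in iota (Q * V) (3 * (Q * V)))%N.
    move=> j1 j2; rewrite mem_iota leq_mul //=.
    rewrite (@leq_trans ((Q + Q) * (V + V))%N) //; last by lia.
    by rewrite ltn_mul.
  by rewrite /g /=; apply/allpairsP; exists (l * m, l * n)%N; rewrite !bnd.
have -> : Q%:R * pair_sum tau (iota V V) = \sum_(x <- s) f (g x).
  rewrite big_allpairs.
  have -> : Q%:R * pair_sum tau (iota V V) =
      \sum_(l <- iota Q Q) pair_sum tau (iota V V).
    by rewrite big_const_seq count_predT size_iota iter_addr addr0 mulr_natl.
  rewrite big_seq [RHS]big_seq; apply: eq_bigr => l; rewrite mem_iota => /andP[lQ _].
  rewrite big_allpairs; rewrite /pair_sum big_seq [RHS]big_seq.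
  apply: eq_bigr => m; rewrite mem_iota => /andP[mV _].
  rewrite big_seq [RHS]big_seq; apply: eq_bigr => n; rewrite mem_iota => /andP[nV _].
  have pos j i : (0 < i)%N -> (i <= j)%N -> 0 < j%:R :> R.
    by move=> ? ij; rewrite ltr0n (leq_trans _ ij).
  rewrite /f /g /= !natrM !lnM ?posrE ?(pos l Q) ?(pos m V) ?(pos n V) //.
  by congr (trig_sum tau _); ring.
have -> : pair_sum tau (iota (Q * V) (3 * (Q * V))) = \sum_(y <- t) f y.
  by rewrite big_allpairs.
apply: big_fiber_le => //.
- by rewrite allpairs_uniq ?iota_uniq // => -[? ?] [? ?].
- by move=> x /in_s[].
- by move=> y _; exact: F0.
move=> [m n] /allpairsP[[m' n'] /= [ms ns [-> ->]]] {m n}.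
move: ms; rewrite mem_iota => /andP[m1 m2].
have m0 : (0 < m')%N by rewrite (leq_trans _ m1) // muln_gt0 Q0.
apply: (@le_trans _ _ (size (divisors m'))%:R); last by rewrite dd // m0 mulSn.
rewrite ler_nat -(size_map (fun x => x.1)).
apply: uniq_leq_size.
  rewrite map_inj_in_uniq.
    rewrite filter_uniq // !allpairs_uniq ?iota_uniq //; try by move=> [? ?] [? ?].
  move=> [l1 [a1 b1]] [l2 [a2 b2]]; rewrite !mem_filter /=.
  move=> /andP[/eqP[E1 E2] /in_s[/= l10 _ _ _]] /andP[/eqP[E3 E4] _] E.
  rewrite -E in E3 E4 *.
  move: E1 E2; rewrite -E3 -E4 => /eqP + /eqP; rewrite !eqn_pmul2l //.
  by move=> /eqP -> /eqP ->.
move=> l /mapP[x]; rewrite mem_filter => /andP[/eqP[E1 _] _] ->.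
by rewrite -dvdn_divisors // -E1 dvdn_mulr.
Qed.

Lemma sum_subset_le (T : eqType) (s t : seq T) (f : T -> R) : uniq s -> uniq t ->
  {subset s <= t} -> (forall x, x \in t -> 0 <= f x) ->
  \sum_(x <- s) f x <= \sum_(x <- t) f x.
Proof.
move=> us ut st f0; rewrite -[leRHS]mul1r.
apply: (@big_fiber_le R T T s t id) => // y _.
by rewrite size_filter (count_uniq_mem _ us); case: (_ \in _).
Qed.

Lemma block_le (V : nat) (s : seq nat) : (0 < V)%N -> uniq s ->
  {subset s <= iota V V} ->
  \sum_(m <- s) \sum_(n <- s) (Num.sqrt m%:R)^-1 * (Num.sqrt n%:R)^-1 *
    trig_sum tau (ln m%:R - ln n%:R) <= pair_sum tau (iota V V) / V%:R.
Proof.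
move=> V0 us sV; pose t := allpairs pair s s.
pose f (p : nat * nat) := trig_sum tau (ln p.1%:R - ln p.2%:R) / V%:R.
have V1 : 0 < V%:R :> R by rewrite ltr0n.
apply: (@le_trans _ _ (\sum_(p <- t) f p)); last first.
  have -> : pair_sum tau (iota V V) / V%:R =
     \sum_(p <- allpairs pair (iota V V) (iota V V)) f p.
    rewrite big_allpairs /pair_sum mulr_suml.
    by apply: eq_bigr => m _; rewrite mulr_suml.
  apply: sum_subset_le; rewrite ?allpairs_uniq ?iota_uniq //;
    try by move=> [? ?] [? ?].
    move=> p /allpairsP[x [/sV x1 /sV x2 ->]].
    by apply/allpairsP; exists x.
  by move=> p _; rewrite divr_ge0 // ltW.
rewrite big_allpairs big_seq [leRHS]big_seq; apply: ler_sum => m ms.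
rewrite big_seq [leRHS]big_seq; apply: ler_sum => n ns.
rewrite /f mulrC ler_wpM2l //= -invfM lef_pV2 ?posrE //.
  rewrite -[leLHS]sqr_sqrtr ?(ltW V1) // expr2.
  have sq j : j \in s -> Num.sqrt V%:R <= Num.sqrt j%:R :> R.
    by move/sV; rewrite mem_iota => /andP[jV _]; rewrite ler_sqrt ?ler0n ?ler_nat.
  by rewrite ler_pM ?sqrtr_ge0 ?sq.
have sq j : j \in s -> 0 < Num.sqrt j%:R :> R.
  by move/sV; rewrite mem_iota sqrtr_gt0 ltr0n => /andP[jV _]; exact: leq_trans jV.
by rewrite mulr_gt0 ?sq.
Qed.

Lemma sum_log_blocks (K lam : nat) (c : nat -> R) : (K < 2 ^ lam.+1)%N ->
  \sum_(n <- iota 1 K) c n =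
  \sum_(j <- iota 0 lam.+1) \sum_(n <- [seq n <- iota 1 K | trunc_log 2 n == j]) c n.
Proof.
move=> Kl; under [RHS]eq_bigr do rewrite big_filter big_mkcond.
rewrite exchange_big /= big_seq [RHS]big_seq; apply: eq_bigr => n.
rewrite mem_iota add1n ltnS => /andP[n0 nK].
have jl : trunc_log 2 n \in iota 0 lam.+1.
  rewrite mem_iota /= add0n -(@ltn_exp2l 2) //.
  by apply: leq_ltn_trans Kl; rewrite (leq_trans _ nK) // trunc_logP.
rewrite (bigD1_seq _ jl (iota_uniq _ _)) /= eqxx big1 ?addr0 // => j.
by rewrite eq_sym => /negPf ->.
Qed.

(** In diagonal form, Cauchy-Schwarz discards pairs from different dyadic blocks at the cost of one
    factor [lam.+1]; the second comes from summing over blocks, each moved to the top window by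
    [pair_sum_multiples]. *)
Lemma weighted_pair_sum_le_window (K lam : nat) (d : R) :
  (K < 2 ^ lam.+1)%N ->
  (forall n, (0 < n < 4 * 2 ^ lam)%N -> (size (divisors n))%:R <= d) ->
  weighted_pair_sum tau K <= lam.+1%:R ^+ 2 * d *
    (pair_sum tau (iota (2 ^ lam) (3 * 2 ^ lam)) / (2 ^ lam)%:R).
Proof.
move=> Kl dd; pose blk j := [seq n <- iota 1 K | trunc_log 2 n == j].
pose w (n : nat) : R := (Num.sqrt n%:R)^-1.
pose P := pair_sum tau (iota (2 ^ lam) (3 * 2 ^ lam)).
have blocks : weighted_pair_sum tau K <= lam.+1%:R * \sum_(j <- iota 0 lam.+1)
   \sum_(m <- blk j) \sum_(n <- blk j) w m * w n *
     trig_sum tau (ln m%:R - ln n%:R).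
  under eq_bigr do rewrite (quadratic_form_trig_sum0 tau _ w (fun n => ln n%:R)).
  rewrite /weighted_pair_sum (quadratic_form_trig_sum0 tau _ w (fun n => ln n%:R)).
  rewrite exchange_big mulr_sumr /=; apply: ler_sum => i _.
  rewrite big_split mulrDr /= lerD // (sum_log_blocks _ Kl);
  by apply: le_trans (sqr_sum_le _ _) _; rewrite size_iota.
apply: (le_trans blocks); rewrite expr2 -!mulrA ler_wpM2l //.
have -> : lam.+1%:R * (d * (P / (2 ^ lam)%:R)) =
    \sum_(j <- iota 0 lam.+1) d * (P / (2 ^ lam)%:R).
  by rewrite big_const_seq count_predT size_iota iter_addr addr0 mulr_natl.
rewrite big_seq [leRHS]big_seq; apply: ler_sum => j; rewrite mem_iota add0n.
rewrite ltnS => /andP[_ jl].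
have V0 : (0 < 2 ^ j)%N by rewrite expn_gt0.
have Q0 : (0 < 2 ^ (lam - j))%N by rewrite expn_gt0.
have QV : (2 ^ (lam - j) * 2 ^ j = 2 ^ lam)%N by rewrite -expnD subnK.
apply: (@le_trans _ _ (pair_sum tau (iota (2 ^ j) (2 ^ j)) / (2 ^ j)%:R)).
  apply: block_le => //; first by rewrite filter_uniq ?iota_uniq.
  move=> n; rewrite mem_filter !mem_iota => /andP[/eqP nj /andP[n0 _]].
  by rewrite -nj trunc_logP //= addnn -mul2n -expnS trunc_log_ltn.
have := @pair_sum_multiples (2 ^ j) (2 ^ (lam - j)) d V0 Q0.
rewrite QV => /(_ dd) le1.
have V1 : 0 < (2 ^ j)%:R :> R by rewrite ltr0n.
have L1 : 0 < (2 ^ lam)%:R :> R by rewrite ltr0n expn_gt0.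
have Q1 : 0 < (2 ^ (lam - j))%:R :> R by rewrite ltr0n.
have QVR : (2 ^ lam)%:R = (2 ^ (lam - j))%:R * (2 ^ j)%:R :> R.
  by rewrite -natrM QV.
rewrite ler_pdivrMr // -(ler_pM2l Q1); apply: (le_trans le1).
rewrite -/P QVR le_eqVlt; apply/orP; left; apply/eqP; field.
by rewrite !gt_eqF.
Qed.

(** The weighted sum is a second moment over [i] of Dirichlet polynomials. Cauchy-Schwarz leads to
    the fourth moment, which is the second moment of their squares, of length K * K; each pair of
    products has at most [d ^+ 2] representations. *)
Lemma sqr_weighted_pair_sum_le (K : nat) (d : R) : 0 <= d ->
  (forall n, (0 < n <= K * K)%N -> (size (divisors n))%:R <= d) ->
  weighted_pair_sum tau K ^+ 2 <=
    #|I|%:R * (d ^+ 2 * weighted_pair_sum tau (K * K)).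
Proof.
move=> d0 dd; pose w (n : nat) : R := (Num.sqrt n%:R)^-1.
pose s := allpairs pair (iota 1 K) (iota 1 K).
pose b (p : nat * nat) := w p.1 * w p.2.
pose l (p : nat * nat) : R := ln p.1%:R + ln p.2%:R.
pose f (y : nat * nat) := w y.1 * w y.2 * trig_sum tau (ln y.1%:R - ln y.2%:R).
pose g (x : (nat * nat) * (nat * nat)) := (x.1.1 * x.1.2, x.2.1 * x.2.2)%N.
pose t := allpairs pair (iota 1 (K * K)) (iota 1 (K * K)).
have in_s p : p \in s ->
    [/\ (0 < p.1)%N, (0 < p.2)%N & p.1 * p.2 \in iota 1 (K * K)]%N.
  case/allpairsP => -[m n] /= [ms ns ->] /=.
  move: ms ns; rewrite !mem_iota => /andP[m1 m2] /andP[n1 n2].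
  split => //; rewrite muln_gt0 m1 n1 add1n ltnS.
  by rewrite leq_mul // -ltnS.
rewrite [in leLHS]/weighted_pair_sum
  (quadratic_form_trig_sum0 tau _ w (fun n => ln n%:R)).
apply: le_trans (sqr_sum_le _ _) _.
rewrite -sum1_size sum1_card ler_wpM2l //.
have -> : \sum_i ((\sum_(p <- iota 1 K) w p * cos (tau i * ln p%:R)) ^+ 2 +
   (\sum_(p <- iota 1 K) w p * sin (tau i * ln p%:R)) ^+ 2) ^+ 2 =
   \sum_(x <- allpairs pair s s) f (g x).
  rewrite big_allpairs.
  transitivity (\sum_(p <- s) \sum_(q <- s) b p * b q * trig_sum tau (l p - l q)).
    rewrite quadratic_form_trig_sum0; apply: eq_bigr => i _.
    set A := \sum_(p <- _) _; set B := \sum_(p <- _) _.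
    (* A^2 - B^2 and 2 A B are the real and imaginary parts of (A + i B)^2. *)
    have -> : \sum_(p <- s) b p * cos (tau i * l p) = A ^+ 2 - B ^+ 2.
      rewrite !expr2 !big_distrlr /= -sumrB big_allpairs; apply: eq_bigr => m _.
      rewrite -sumrB; apply: eq_bigr => n _.
      by rewrite /b /l /= mulrDr cosD; ring.
    have -> : \sum_(p <- s) b p * sin (tau i * l p) = 2 * (A * B).
      rewrite mulr2n mulrDl mul1r {1}[A * B]mulrC.
      rewrite !big_distrlr /= -big_split big_allpairs; apply: eq_bigr => m _.
      rewrite -big_split; apply: eq_bigr => n _.
      by rewrite /b /l /= mulrDr sinD; ring.
    by ring.
  rewrite big_seq [RHS]big_seq; apply: eq_bigr => p /in_s[p1 p2 _].
  rewrite big_seq [RHS]big_seq; apply: eq_bigr => q /in_s[q1 q2 _].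
  have sqM (m n : nat) : w (m * n)%N = w m * w n.
    by rewrite /w natrM sqrtrM // invfM.
  rewrite /f /g /= !sqM !natrM !lnM ?posrE ?ltr0n //.
have -> : weighted_pair_sum tau (K * K) = \sum_(y <- t) f y by rewrite big_allpairs.
apply: big_fiber_le.
- by rewrite allpairs_uniq ?iota_uniq // => -[? ?] [? ?].
- move=> x /allpairsP[[p q] /= [/in_s[_ _ p3] /in_s[_ _ q3] ->]].
  by apply/allpairsP; exists (p.1 * p.2, q.1 * q.2)%N.
- move=> y _; rewrite !mulr_ge0 ?F0 //; by rewrite invr_ge0 sqrtr_ge0.
move=> [m n] /allpairsP[[m' n'] /= [ms ns [-> ->]]] {m n}.
move: ms ns; rewrite !mem_iota !add1n !ltnS => m1 n1.
have m0 : (0 < m')%N by case/andP: m1.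
have n0 : (0 < n')%N by case/andP: n1.
apply: (@le_trans _ _ (size (divisors m') * size (divisors n'))%:R); last first.
  by rewrite natrM expr2 ler_pM // dd.
rewrite ler_nat -(size_map (fun x => (x.1.1, x.2.1))).
rewrite -(size_allpairs (@pair nat nat)); apply: uniq_leq_size.
  rewrite map_inj_in_uniq.
    rewrite filter_uniq // !allpairs_uniq ?iota_uniq //; try by move=> [? ?] [? ?].
  move=> [[a1 b1] [c1 e1]] [[a2 b2] [c2 e2]]; rewrite !mem_filter /g /=.
  move=> /andP[/eqP[E1 E2] /allpairsP[[p q] /= [/in_s + /in_s + [Ep Eq]]]].
  rewrite -{}Ep -{}Eq /= => -[a0 _ _] [c0 _ _] /andP[/eqP[E3 E4] _] [Ea Ec].
  move: E1 E2; rewrite -Ea -Ec in E3 E4 *; rewrite -E3 -E4 => /eqP + /eqP.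
  by rewrite !eqn_pmul2l // => /eqP -> /eqP ->.
move=> y /mapP[x]; rewrite mem_filter => /andP[/eqP[E1 E2] _] ->.
apply/allpairsP; exists (x.1.1, x.2.1) => /=.
by rewrite -!dvdn_divisors // -E1 -E2 !dvdn_mulr.
Qed.

End Divisors.

(** * The additive energy *)

Section Energy.
Variable R : realType.

(** The terms are dominated by the increments of [phi], which telescope and stay within [-3, 3]. *)
Lemma sum_inv_sqr_le (a V : nat) :
  \sum_(b < V) (1 + (a%:R - b%:R) ^+ 2)^-1 <= 6 :> R.
Proof.
pose phi (v : nat) : R := if (v <= a)%N then -3 + 3 / (a - v).+1%:R
   else 3 - 3 / (v - a).+1%:R.
have key (d : nat) : (1 + d%:R ^+ 2)^-1 <= 3 / d.+1%:R - 3 / d.+2%:R :> R.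
  have d0 : 0 <= d%:R :> R by [].
  rewrite -(natr1 d.+1) -(natr1 d).
  have -> : 3 / (d%:R + 1) - 3 / (d%:R + 1 + 1) =
     3 / ((d%:R + 1) * (d%:R + 1 + 1)) :> R by field; lra.
  rewrite ler_pdivlMr ?mulr_gt0 //; try lra.
  rewrite mulrC ler_pdivrMr; last by have := sqr_ge0 (d%:R : R); lra.
  case: d d0 => [|d] d0; first by lra.
  by rewrite -(natr1 d); have : 0 <= d%:R :> R by []; nra.
have frac0 (n : nat) : 0 <= 3 / n.+1%:R :> R by [].
have frac3 (n : nat) : 3 / n.+1%:R <= 3 :> R.
  by rewrite ler_pdivrMr // ler_peMr // ler1n.
have bound v : phi v <= 3.
  rewrite /phi; case: ifP => _; [have := frac3 (a - v)%N|have := frac0 (v - a)%N];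
  by move: (3 / _) => x; lra.
suff : \sum_(b < V) (1 + (a%:R - b%:R) ^+ 2)^-1 <= phi V + 3 :> R.
  by have := bound V; lra.
elim: V => [|V IH].
  rewrite big_ord0 /phi /=.
  by have := frac0 (a - 0)%N; move: (3 / _) => x; lra.
rewrite big_ord_recr /=; apply: (le_trans (lerD IH (lexx _))).
rewrite addrAC lerD2r -lerBrDl.
rewrite /phi; case: (ltngtP V a) => [Va|aV|->].
- rewrite -natrB 1?ltnW // -!(subnSK Va); move: (a - V.+1)%N => c.
  apply: (@le_trans _ _ (1 + c%:R ^+ 2)^-1).
    have pos (d : nat) : 0 < 1 + d%:R ^+ 2 :> R by rewrite ltr_wpDr ?sqr_ge0.
    rewrite lef_pV2 ?posrE ?pos // lerD2l.
    by rewrite ler_sqr ?nnegrE // ler_nat.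
  by apply: (le_trans (key _)); move: (3 / _) (3 / _) => x y; lra.
- rewrite -opprB sqrrN -natrB 1?ltnW // subSn 1?ltnW //.
  by apply: (le_trans (key _)); move: (3 / _) (3 / _) => x y; lra.
rewrite subrr subnn subSnn.
by rewrite expr0n addr0 invr1; lra.
Qed.

(* Schur's test over unit cells: points in a common cell are 1-close. *)
Lemma large_sieve_energy (S : finType) (sg : S -> R) : (forall s, 0 <= sg s) ->
  \sum_s \sum_s' (1 + (sg s - sg s') ^+ 2)^-1 <=
  18 * \sum_s \sum_s' (`|sg s - sg s'| <= 1)%R%:R.
Proof.
move=> sg0.
pose fl s := Num.truncn (sg s).
have flP s : (fl s)%:R <= sg s < (fl s)%:R + 1.
  by rewrite natr1 truncn_le sg0 truncnS_gt.
pose V := (\max_s fl s).+1.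
have flV s : (fl s < V)%N by rewrite ltnS leq_bigmax.
pose h (a b : nat) : R := (1 + (a%:R - b%:R) ^+ 2)^-1.
pose c (a : nat) : R := \sum_s (fl s == a)%:R.
have c_sum (f : nat -> R) : \sum_s f (fl s) = \sum_(a < V) c a * f a.
  rewrite /c; under [RHS]eq_bigr do rewrite mulr_suml.
  rewrite exchange_big /=; apply: eq_bigr => s _.
  rewrite (bigD1 (Ordinal (flV s))) //= eqxx mul1r big1 ?addr0 // => a.
  by rewrite -val_eqE /= eq_sym => /negPf ->; rewrite mul0r.
(* Passing to integer parts changes a difference by at most 1, which costs a factor 3; with the 6 of
   [sum_inv_sqr_le] this makes 18. *)
have le1 : \sum_s \sum_s' (1 + (sg s - sg s') ^+ 2)^-1 <=
    3 * \sum_s \sum_s' h (fl s) (fl s').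
  rewrite mulr_sumr; apply: ler_sum => s _.
  rewrite mulr_sumr; apply: ler_sum => s' _.
  have := flP s; have := flP s'.
  set x := sg s; set y := sg s'; set m := (fl s)%:R; set n := (fl s')%:R.
  move=> /andP[y1 y2] /andP[x1 x2].
  have x0 := sqr_ge0 (x - y); have m0 := sqr_ge0 (m - n).
  rewrite -[leLHS]mul1r ler_pdivrMr; last by lra.
  rewrite mulrAC ler_pdivlMr; last by lra.
  have : (m - n) ^+ 2 <= 2 * (x - y) ^+ 2 + 2.
    pose e := (m - n) - (x - y).
    have e1 : e ^+ 2 <= 1.
      rewrite -real_normK ?num_real // expr_le1 // ler_norml /e.
      by apply/andP; split; lra.
    by have := sqr_ge0 (x - y - e); rewrite /e in e1 *; lra.
  by lra.
have sym a b : h a b = h b a by rewrite /h -opprB sqrrN.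
have h0 a b : 0 <= h a b by rewrite invr_ge0 addr_ge0 ?sqr_ge0.
have schur : \sum_s \sum_s' h (fl s) (fl s') <= 6 * \sum_(a < V) c a ^+ 2.
  under eq_bigr do rewrite c_sum.
  rewrite (c_sum (fun m => \sum_(a < V) c a * h m a)).
  apply: (@le_trans _ _ (\sum_(a < V) \sum_(b < V)
     (h a b * c a ^+ 2 / 2 + h a b * c b ^+ 2 / 2))).
    apply: ler_sum => a _; rewrite mulr_sumr; apply: ler_sum => b _.
    have := mulr_ge0 (h0 a b) (sqr_ge0 (c a - c b)); rewrite sqrrB; lra.
  under eq_bigr do rewrite big_split /=.
  rewrite big_split /=.
  have half : \sum_(a < V) \sum_(b < V) h a b * c a ^+ 2 / 2 <=
      3 * \sum_(a < V) c a ^+ 2.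
    rewrite mulr_sumr; apply: ler_sum => a _.
    rewrite -mulr_suml -mulr_suml.
    have := ler_wpM2r (sqr_ge0 (c a)) (sum_inv_sqr_le a V).
    by rewrite -/(h a _); lra.
  rewrite [X in _ + X]exchange_big /=.
  under [X in _ + X]eq_bigr => a _ do under eq_bigr => b _ do rewrite sym.
  by move: half; lra.
have diag : \sum_(a < V) c a ^+ 2 <= \sum_s \sum_s' (`|sg s - sg s'| <= 1)%R%:R.
  under eq_bigr do rewrite expr2.
  rewrite -(c_sum c) /c; apply: ler_sum => s _; apply: ler_sum => s' _.
  case: eqP => // E; rewrite ler_nat lt0b.
  have := flP s; have := flP s'; rewrite E => /andP[y1 y2] /andP[x1 x2].
  by rewrite ler_norml; apply/andP; split; lra.
by move: le1 schur diag; lra.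
Qed.

(** * Complex exponentials and the mean square as a weighted pair sum *)

Definition cis (x : R) : complex R := Complex (cos x) (sin x).

Lemma cisD x y : cis (x + y) = cis x * cis y.
Proof.
by apply/eqP; rewrite eq_complex /= cosD sinD; apply/andP; split; apply/eqP; ring.
Qed.

Lemma cis0 : cis 0 = 1.
Proof. by rewrite /cis cos0 sin0. Qed.

Lemma cis_sum (J : Type) (s : seq J) (f : J -> R) :
  cis (\sum_(j <- s) f j) = \prod_(j <- s) cis (f j).
Proof. exact: (big_morph cis cisD cis0). Qed.

Lemma Re_sum (J : Type) (s : seq J) (f : J -> complex R) :
  complex.Re (\sum_(j <- s) f j) = \sum_(j <- s) complex.Re (f j).
Proof. by apply: (big_morph (@complex.Re R)) => // -[a b] [c d]. Qed.

Lemma Im_sum (J : Type) (s : seq J) (f : J -> complex R) :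
  complex.Im (\sum_(j <- s) f j) = \sum_(j <- s) complex.Im (f j).
Proof. by apply: (big_morph (@complex.Im R)) => // -[a b] [c d]. Qed.

Variables (k : nat) (A : {fset R}).
Let tau := @alt_sum R A k.

(** The sum over tuples factors over coordinates into Z^k times the k-th power of its conjugate,
    that is |Z|^(2k). *)
Lemma sum_cis_alt_sum (y : R) : exists2 r : R, 0 <= r &
  \sum_(t : {ffun 'I_(k + k) -> A}) cis (tau t * y) = Complex r 0.
Proof.
pose Z := \sum_(a : A) cis (val a * y); pose Z' := \sum_(a : A) cis (- (val a * y)).
have -> : \sum_(t : {ffun 'I_(k + k) -> A}) cis (tau t * y) = (Z * Z') ^+ k.
  pose f (j : 'I_(k + k)) (a : A) : complex R :=
    if fintype.split j is inl _ then cis (val a * y) else cis (- (val a * y)).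
  transitivity (\prod_(j < k + k) \sum_(a : A) f j a).
    rewrite bigA_distr_bigA /=; apply: eq_bigr => t _.
    rewrite big_split_ord /= /tau /alt_sum mulrBl cisD -mulNr -sumrN !mulr_suml.
    rewrite !cis_sum; congr (_ * _); apply: eq_bigr => j _.
      by rewrite /f (unsplitK (inl j)).
    by rewrite /f (unsplitK (inr j)) mulNr.
  rewrite big_split_ord exprMn_comm /=; last exact: mulrC.
  by congr (_ * _); rewrite -[in RHS](card_ord k) -prodr_const; apply: eq_bigr => j _;
    apply: eq_bigr => a _; rewrite /f ?(unsplitK (inl j)) ?(unsplitK (inr j)).
have ReZ' : complex.Re Z' = complex.Re Z.
  by rewrite !Re_sum; apply: eq_bigr => a _; rewrite /= cosN.
have ImZ' : complex.Im Z' = - complex.Im Z.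
  by rewrite !Im_sum -sumrN; apply: eq_bigr => a _; rewrite /= sinN.
have -> : Z * Z' = ((complex.Re Z ^+ 2 + complex.Im Z ^+ 2)%:C)%C.
  move: ReZ' ImZ'; case: Z => a b; case: Z' => c d /= -> ->.
  by apply/eqP; rewrite eq_complex /=; apply/andP; split; apply/eqP; ring.
set r := complex.Re Z ^+ 2 + _.
exists (r ^+ k); first by rewrite exprn_ge0 // addr_ge0 ?sqr_ge0.
by rewrite -rmorphXn.
Qed.

Lemma trig_sum_alt_sum_ge0 (y : R) : 0 <= trig_sum tau y.
Proof.
have [r r0 /(congr1 (@complex.Re R))] := sum_cis_alt_sum y.
by rewrite Re_sum /trig_sum => /= ->.
Qed.

Lemma sum_sin_alt_sum (y : R) :
  \sum_(t : {ffun 'I_(k + k) -> A}) sin (tau t * y) = 0.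
Proof.
have [r r0 /(congr1 (@complex.Im R))] := sum_cis_alt_sum y.
by rewrite Im_sum.
Qed.

Lemma cpow_half (n : nat) (x : R) : (0 < n)%N ->
  cpow n%:R (Complex (- (1 / 2)) x) =
  Complex ((Num.sqrt n%:R)^-1 * cos (x * ln n%:R))
          ((Num.sqrt n%:R)^-1 * sin (x * ln n%:R)).
Proof.
move=> n0; rewrite /cpow /=.
have -> : expR (- (1 / 2) * ln n%:R) = (Num.sqrt n%:R)^-1 :> R; last by [].
have n1 : 0 < n%:R :> R by rewrite ltr0n.
rewrite mulNr expRN; congr (_^-1).
rewrite -powR12_sqrt ?ltW // /powR gt_eqF //.
by rewrite mul1r.
Qed.

(** After expanding the square and summing over tuples, the sine terms vanish. Each remaining
    coefficient Re(a_m conj(a_n)) is at most 1 and multiplies a nonnegative [trig_sum], so it may be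
    replaced by 1 and the range enlarged. *)
Lemma energy_mean_square_le (N : R) (a : nat -> complex R) : 1 <= N ->
  (forall n, Normc.normc (a n) <= 1) ->
  energy_mean_square k A N a <= weighted_pair_sum tau (Num.truncn (2 * N)).
Proof.
move=> N1 a1; set M := Num.truncn _.
pose s := [seq n <- index_iota 0 M.+1 | N <= n%:R].
pose w (n : nat) : R := (Num.sqrt n%:R)^-1.
pose u n := complex.Re (a n); pose v n := complex.Im (a n).
have s0 n : n \in s -> (0 < n)%N.
  rewrite mem_filter => /andP[Nn _]; rewrite -(ltr_nat R).
  by apply: lt_le_trans Nn; lra.
pose th (t : {ffun 'I_(k + k) -> A}) (n : nat) := tau t * ln n%:R.
have normE t : Normc.normc (dirichlet_poly N a (Complex (- (1 / 2)) (tau t))) ^+ 2 =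
    \sum_(m <- s) \sum_(n <- s) w m * w n *
      ((u m * u n + v m * v n) * cos (tau t * (ln m%:R - ln n%:R)) +
       (u m * v n - v m * u n) * sin (tau t * (ln m%:R - ln n%:R))).
  have -> : dirichlet_poly N a (Complex (- (1 / 2)) (tau t)) =
      Complex (\sum_(n <- s) w n * (u n * cos (th t n) - v n * sin (th t n)))
              (\sum_(n <- s) w n * (u n * sin (th t n) + v n * cos (th t n))).
    rewrite /dirichlet_poly -big_filter -/s.
    apply/eqP; rewrite eq_complex /= Re_sum Im_sum big_seq [X in _ == X]big_seq.
    rewrite [X in _ && (X == _)]big_seq [X in _ && (_ == X)]big_seq.
    by apply/andP; split; apply/eqP; apply: eq_bigr => n /s0 n0;
      rewrite cpow_half // /u /v /w /th; case: (a n) => x y /=; ring.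
  rewrite /= sqr_sqrtr ?addr_ge0 ?sqr_ge0 // !expr2 !big_distrlr /= -big_split.
  apply: eq_bigr => m _; rewrite -big_split; apply: eq_bigr => n _ /=.
  by rewrite [tau t * (_ - _)]mulrBr cosB sinB /th; ring.
have -> : energy_mean_square k A N a = \sum_(m <- s) \sum_(n <- s)
    w m * w n * (u m * u n + v m * v n) * trig_sum tau (ln m%:R - ln n%:R).
  rewrite /energy_mean_square; under eq_bigr do rewrite normE.
  rewrite exchange_big /=; apply: eq_bigr => m _.
  rewrite exchange_big /=; apply: eq_bigr => n _.
  rewrite -mulr_sumr big_split /= -!mulr_sumr sum_sin_alt_sum mulr0 addr0.
  by rewrite mulrA.
apply: (@le_trans _ _ (\sum_(m <- s) \sum_(n <- s)
    w m * w n * trig_sum tau (ln m%:R - ln n%:R))).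
  apply: ler_sum => m _; apply: ler_sum => n _.
  rewrite ler_wpM2r ?trig_sum_alt_sum_ge0 //.
  rewrite ler_piMr ?mulr_ge0 ?invr_ge0 ?sqrtr_ge0 //.
  have nrm j : u j ^+ 2 + v j ^+ 2 <= 1.
    have := a1 j; rewrite /u /v; case: (a j) => x y /= xy.
    have := sqr_sqrtr (addr_ge0 (sqr_ge0 x) (sqr_ge0 y)) => <-.
    by rewrite expr_le1 ?sqrtr_ge0.
  have := nrm m; have := nrm n.
  have := sqr_ge0 (u m - u n); have := sqr_ge0 (v m - v n).
  by rewrite !sqrrB; lra.
have ssub : {subset s <= iota 1 M}.
  move=> n ns; rewrite mem_iota s0 //= add1n.
  by move: ns; rewrite mem_filter mem_index_iota => /andP[_ /andP[]].
have us : uniq s by rewrite filter_uniq // iota_uniq.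
have := @sum_subset_le R _ (allpairs pair s s)
  (allpairs pair (iota 1 M) (iota 1 M))
  (fun p => w p.1 * w p.2 * trig_sum tau (ln p.1%:R - ln p.2%:R)).
rewrite !big_allpairs; apply.
- by rewrite allpairs_uniq // => -[? ?] [? ?].
- by rewrite allpairs_uniq ?iota_uniq // => -[? ?] [? ?].
- by move=> p /allpairsP[x [/ssub x1 /ssub x2 ->]]; apply/allpairsP; exists x.
by move=> p _; rewrite !mulr_ge0 ?invr_ge0 ?sqrtr_ge0 ?trig_sum_alt_sum_ge0.
Qed.

Lemma alt_sum_norm_le (T : R) : (forall t, t \in A -> 0 <= t <= T) ->
  forall t, `|tau t| <= k%:R * T.
Proof.
move=> AT t.
have bnd (f : 'I_k -> A) : 0 <= \sum_(j < k) val (f j) <= k%:R * T.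
  apply/andP; split.
    by apply: sumr_ge0 => j _; have /andP[] := AT _ (valP (f j)).
  rewrite -[k in k%:R](card_ord k) mulr_natl -sumr_const; apply: ler_sum => j _.
  by have /andP[] := AT _ (valP (f j)).
have /andP[x1 x2] := bnd (fun j => t (lshift k j)).
have /andP[y1 y2] := bnd (fun j => t (rshift k j)).
by rewrite /tau /alt_sum ler_norml; apply/andP; split; lra.
Qed.

Lemma sum_alt_sum_split (f : R -> R) :
  \sum_(t : {ffun 'I_(k + k) -> A}) f (tau t) =
  \sum_(p : {ffun 'I_k -> A}) \sum_(q : {ffun 'I_k -> A})
     f (\sum_(j < k) val (p j) - \sum_(j < k) val (q j)).
Proof.
rewrite pair_bigA /=.
pose g (x : {ffun 'I_k -> A} * {ffun 'I_k -> A}) : {ffun 'I_(k + k) -> A} :=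
  [ffun j => match fintype.split j with inl i => x.1 i | inr i => x.2 i end].
pose h (t : {ffun 'I_(k + k) -> A}) : {ffun 'I_k -> A} * {ffun 'I_k -> A} :=
  ([ffun i => t (lshift k i)], [ffun i => t (rshift k i)]).
have gh : cancel h g.
  move=> t; apply/ffunP => j; rewrite ffunE; case: fintype.splitP => i ij /=;
  by rewrite ffunE; congr (t _); apply: val_inj; rewrite /= ij.
rewrite (reindex g) /=; last first.
  exists h => [[p q] _|t _]; last exact: gh.
  congr pair; apply/ffunP => i; rewrite !ffunE.
    by rewrite (unsplitK (inl i)).
  by rewrite (unsplitK (inr i)).
apply: eq_bigr => -[p q] _ /=; congr (f (_ - _)); apply: eq_bigr => j _;
  by rewrite ffunE ?(unsplitK (inl j)) ?(unsplitK (inr j)).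
Qed.

(** An alternating sum is a difference of two nonnegative [k]-fold sums, and the close pairs of such
    sums are what [additive_energy] counts. *)
Lemma sum_inv_alt_sum_le : (forall t, t \in A -> 0 <= t) ->
  \sum_t (1 + tau t ^+ 2)^-1 <= 18 * (additive_energy k A)%:R.
Proof.
move=> A0; rewrite (sum_alt_sum_split (fun x => (1 + x ^+ 2)^-1)).
have -> : (additive_energy k A)%:R =
    \sum_(t : {ffun 'I_(k + k) -> A}) (`|tau t| <= 1)%R%:R :> R.
  rewrite /additive_energy -sum1_card natr_sum big_mkcond; apply: eq_bigr => t _.
  by rewrite inE; case: (_ <= _).
rewrite (sum_alt_sum_split (fun x => (`|x| <= 1)%R%:R)).
apply: large_sieve_energy => p; apply: sumr_ge0 => j _.
exact: A0 (valP (p j)).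
Qed.

End Energy.

(** * Combining reflection and squaring *)

Section Bootstrap.
Variables (R : realType) (G : nat -> R) (N T B X E W : R).
Hypothesis G0 : forall K, 0 <= G K.
Hypothesis G_le : forall K K', (K <= K')%N -> G K <= G K'.
Hypotheses (N1 : 1 <= N) (T1 : 1 <= T) (B2 : 2 <= B) (W1 : 1 <= W).
Hypotheses (E1 : 1 <= E) (EX : E <= X).
(** A common bound for all lengths at which reflection and squaring are applied, so that a single
    loss factor [W] serves throughout. *)
Let Y := 2 * B * (N * T).
Hypothesis reflect : forall (L : R) (K : nat), 1 <= L <= Y -> K%:R <= L ->
  G K <= W * (L * E + G (Num.truncn (B * T / L))).
Hypothesis square : forall K : nat, (K * K)%:R <= Y ->
  G K ^+ 2 <= X * W ^+ 2 * G (K * K).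

Let N0 : 0 <= N := le_trans ler01 N1.
Let T0 : 0 <= T := le_trans ler01 T1.
Let B0 : 0 <= B := le_trans (ler0n R 2) B2.
Let B1 : 1 <= B. Proof. by apply: le_trans B2; rewrite ler1n. Qed.
Let W0 : 0 <= W := le_trans ler01 W1.
Let E0 : 0 <= E := le_trans ler01 E1.
Let X0 : 0 <= X := le_trans E0 EX.

(* For such [P], reflecting at length [P] and then squaring returns to a length
   at most [P], so the bound closes up by AM-GM. *)
Lemma bootstrap_long (P : R) (K : nat) : 1 <= P <= Y ->
  (B * T) ^+ 2 <= P ^+ 3 -> K%:R <= P -> G K <= 2 * W * P * E + W ^+ 4 * X.
Proof.
move=> PY BTP KP; case/andP: (PY) => P1 P2; have P0 := le_trans ler01 P1.
have [h1 h2 h3] := And3 T1 B2 W1; have [h4 h5] := conj E1 EX.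
pose p := Num.truncn P; pose q := Num.truncn (B * T / P).
have pP : p%:R <= P by rewrite truncn_le; lra.
have Kp : (K <= p)%N by rewrite truncn_ge_nat //; lra.
have qBT : q%:R <= B * T / P by rewrite truncn_le divr_ge0 ?mulr_ge0 //.
have qqP : (q * q)%:R <= P.
  rewrite natrM; apply: (@le_trans _ _ ((B * T / P) ^+ 2)).
    by rewrite expr2 ler_pM.
  by rewrite expr_div_n ler_pdivrMr -?exprS // exprn_gt0 //; lra.
have qp : (q * q <= p)%N by rewrite truncn_ge_nat //; lra.
have Rp := reflect PY pP.
have Sq := square (le_trans qqP P2).
have {}Sq : G q ^+ 2 <= X * W ^+ 2 * G p.
  apply: (le_trans Sq); rewrite ler_wpM2l ?G_le //.
  by rewrite mulr_ge0 ?sqr_ge0 //; lra.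
(* Half of [G p] appears on the right and is then absorbed into the left side of the reflected
   inequality. *)
have amgm : W * G q <= (W ^+ 4 * X + G p) / 2.
  have W4 : 0 <= W ^+ 4 * X by rewrite mulr_ge0 ?exprn_ge0 //.
  have rhs0 : 0 <= (W ^+ 4 * X + G p) / 2 by rewrite divr_ge0 ?addr_ge0.
  rewrite -ler_sqr ?nnegrE ?rhs0 ?mulr_ge0 //.
  apply: (@le_trans _ _ (W ^+ 2 * (X * W ^+ 2 * G p))).
    by rewrite exprMn ler_wpM2l ?sqr_ge0.
  by have := sqr_ge0 (W ^+ 4 * X - G p); lra.
apply: (le_trans (G_le Kp)); rewrite -/q in Rp; lra.
Qed.

Lemma bootstrap_large : T ^+ 2 <= N ^+ 3 ->
  G (Num.truncn (2 * N)) <= 4 * B * W ^+ 4 * (X + N * E).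
Proof.
move=> TN.
have [h1 h2 h3] := And3 T1 B2 W1; have [h4 h5 h6] := And3 E1 EX N1.
have NE : 0 <= N * E by rewrite mulr_ge0 //.
have W4 : W <= W ^+ 4 by rewrite ler_eXnr //; lra.
have le2 : (Num.truncn (2 * N))%:R <= 2 * N by rewrite truncn_le; lra.
apply: le_trans (bootstrap_long (P := B * N) _ _ _) _.
- have : N <= N * T by rewrite ler_peMr //; lra.
  by move=> NT; apply/andP; split; [nra|rewrite /Y; nra].
- rewrite exprMn (_ : (B * N) ^+ 3 = B ^+ 2 * (B * N ^+ 3)); last by ring.
  rewrite ler_wpM2l ?sqr_ge0 //.
  by apply: (le_trans TN); rewrite ler_peMl ?exprn_ge0 //.
- by apply: (le_trans le2); rewrite ler_wpM2r //; lra.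
have : W * (B * (N * E)) <= W ^+ 4 * (B * (N * E)).
  by rewrite ler_wpM2r // mulr_ge0 //.
have : W ^+ 4 * X <= B * (W ^+ 4 * X).
  by rewrite ler_peMl // mulr_ge0 ?exprn_ge0.
have : 0 <= W ^+ 4 * (B * (N * E)) by rewrite !mulr_ge0 ?exprn_ge0 //.
have : 0 <= B * (W ^+ 4 * X) by rewrite !mulr_ge0 ?exprn_ge0 //.
lra.
Qed.

(** For [N] below t = T^(2/3), monotonicity allows the use of the shortest admissible length, about
    t, at the price of t E in place of N E. *)
Lemma bootstrap_cube_root (t : R) : 1 <= t -> t ^+ 3 = T ^+ 2 -> N <= t ->
  G (Num.truncn (2 * N)) <= 4 * B * W ^+ 4 * (X + t * E).
Proof.
move=> t1 tT Nt; have t0 := le_trans ler01 t1.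
have [h1 h2 h3] := And3 T1 B2 W1; have [h4 h5 h6] := And3 E1 EX N1.
have tE : 0 <= t * E by rewrite mulr_ge0 //.
have W4 : W <= W ^+ 4 by rewrite ler_eXnr //; lra.
have le2 : (Num.truncn (2 * N))%:R <= 2 * N by rewrite truncn_le; lra.
have tT1 : t <= T.
  rewrite -(@ler_pXn2r _ 3) ?nnegrE //; try lra.
  by rewrite tT -[leLHS]mulr1 [leRHS]exprSr ler_wpM2l ?sqr_ge0.
have TNT : T <= N * T by rewrite ler_peMl //; lra.
apply: le_trans (bootstrap_long (P := B * t) _ _ _) _.
- by apply/andP; split; [nra|rewrite /Y; nra].
- rewrite exprMn (_ : (B * t) ^+ 3 = B ^+ 2 * (B * t ^+ 3)); last by ring.
  rewrite tT ler_wpM2l ?sqr_ge0 //.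
  by rewrite ler_peMl ?sqr_ge0.
- by apply: (le_trans le2); apply: ler_pM => //; lra.
have : W * (B * (t * E)) <= W ^+ 4 * (B * (t * E)).
  by rewrite ler_wpM2r // mulr_ge0 //.
have : W ^+ 4 * X <= B * (W ^+ 4 * X).
  by rewrite ler_peMl // mulr_ge0 ?exprn_ge0.
have : 0 <= W ^+ 4 * (B * (t * E)) by rewrite !mulr_ge0 ?exprn_ge0 //.
have : 0 <= B * (W ^+ 4 * X) by rewrite !mulr_ge0 ?exprn_ge0 //.
lra.
Qed.

(* The last hypothesis makes [M * E] the third term T^(1/2) |A|^(k/2) E^(3/4). *)
Lemma bootstrap_short (t M : R) : t ^+ 3 = T ^+ 2 -> 1 <= t -> N <= t ->
  0 < M -> M <= t -> M ^+ 4 * E = T ^+ 2 * X ->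
  G (Num.truncn (2 * N)) <= 4 * B * W ^+ 4 * (X + N * E + M * E).
Proof.
move=> tT t1 Nt M0 Mt ME; have t0 := le_trans ler01 t1.
have [h1 h2 h3] := And3 T1 B2 W1; have [h4 h5 h6] := And3 E1 EX N1.
have le2 : (Num.truncn (2 * N))%:R <= 2 * N by rewrite truncn_le; lra.
have tT1 : t <= T.
  rewrite -(@ler_pXn2r _ 3) ?nnegrE //; try lra.
  by rewrite tT -[leLHS]mulr1 [leRHS]exprSr ler_wpM2l ?sqr_ge0.
have TNT : T <= N * T by rewrite ler_peMl //; lra.
have NNT : N <= N * T by rewrite ler_peMr //; lra.
have M2T : T <= M ^+ 2.
  rewrite -ler_sqr ?nnegrE ?sqr_ge0 //.
  rewrite -exprM -(@ler_pM2r _ E); last by lra.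
  by rewrite ME ler_wpM2l ?sqr_ge0.
(* [M] balances the two contributions: [L * E] contains M E, and squaring the reflected sum of
   length at most T / M gives about the square root of X P E, again M E up to constants. *)
pose L := B * (N + M); pose q := Num.truncn (B * T / L).
have LY : 1 <= L <= Y by apply/andP; rewrite /L /Y; split; nra.
have [L1 L2] := andP LY; have L0 := le_trans ler01 L1.
have TM0 : 0 <= T / M by rewrite divr_ge0 // ltW.
have qTM : q%:R <= T / M.
  apply: (@le_trans _ _ (B * T / L)); first by rewrite truncn_le divr_ge0 // mulr_ge0.
  rewrite ler_pdivrMr; last by lra.
  rewrite mulrAC ler_pdivlMr // /L; nra.
(* [P] is admissible in [bootstrap_long]: M <= t gives M^6 <= T^4, hence P^3 >= (B T)^2. *)
pose P := B * (T / M) ^+ 2.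
have TM2 : (T / M) ^+ 2 <= T.
  rewrite expr_div_n ler_pdivrMr ?exprn_gt0 // expr2 ler_wpM2l //; lra.
have TM1 : 1 <= T / M by rewrite ler_pdivlMr //; lra.
have PY : 1 <= P <= Y.
  have : 1 <= (T / M) ^+ 2 by rewrite expr_ge1.
  by move=> TM3; apply/andP; rewrite /P /Y; split; nra.
have qq : (q * q)%:R <= (T / M) ^+ 2 by rewrite natrM expr2 ler_pM.
have qqP : (q * q)%:R <= P by apply: (le_trans qq); rewrite ler_peMl ?sqr_ge0.
have M6 : M ^+ 6 <= T ^+ 4.
  have -> : T ^+ 4 = t ^+ 6 by rewrite (exprM T 2 2) -tT -exprM.
  by rewrite ler_pXn2r ?nnegrE //; lra.
have BTP : (B * T) ^+ 2 <= P ^+ 3.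
  rewrite /P exprMn.
  rewrite (_ : (_ * _) ^+ 3 = B ^+ 2 * (T ^+ 2 * (B * T ^+ 4) / M ^+ 6)); last first.
    by field; lra.
  rewrite ler_wpM2l ?sqr_ge0 // ler_pdivlMr ?exprn_gt0 //.
  rewrite ler_wpM2l ?sqr_ge0 // (le_trans M6) // ler_peMl ?exprn_ge0 //.
have long := bootstrap_long PY BTP qqP.
have Sq := square (le_trans qqP (proj2 (andP PY))).
pose D := M * E.
have D0 : 0 <= D by rewrite mulr_ge0 // ltW.
have PEX : X * (P * E) = B * D ^+ 2.
  have ME' : T ^+ 2 * X / M ^+ 2 = M ^+ 2 * E.
    by rewrite -ME; field; lra.
  transitivity (B * (T ^+ 2 * X / M ^+ 2) * E); last by rewrite ME' /D; ring.
  by rewrite /P; field; lra.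
have Gq : G q <= 2 * B * W ^+ 2 * D + W ^+ 3 * X.
  have WX0 : 0 <= W ^+ 3 * X by rewrite mulr_ge0 // exprn_ge0.
  have WD0 : 0 <= B * W ^+ 2 * D by rewrite mulr_ge0 // mulr_ge0 // exprn_ge0.
  have rhs0 : 0 <= 2 * B * W ^+ 2 * D + W ^+ 3 * X by lra.
  rewrite -ler_sqr ?nnegrE ?G0 //.
  apply: (le_trans Sq).
  apply: (@le_trans _ _ (X * W ^+ 2 * (2 * W * P * E + W ^+ 4 * X))).
    by rewrite ler_wpM2l ?mulr_ge0 ?exprn_ge0 //.
  have -> : X * W ^+ 2 * (2 * W * P * E + W ^+ 4 * X) =
      2 * W ^+ 3 * (B * D ^+ 2) + (W ^+ 3 * X) ^+ 2 by rewrite -PEX; ring.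
  have : 2 * W ^+ 3 * (B * D ^+ 2) <= (2 * B * W ^+ 2 * D) ^+ 2.
    have -> : (2 * B * W ^+ 2 * D) ^+ 2 = (4 * B * W) * (W ^+ 3 * (B * D ^+ 2)).
      by ring.
    have BW : 2 <= 4 * B * W by have : 2 * 1 <= B * W by [apply: ler_pM]; lra.
    rewrite -mulrA; apply: ler_wpM2r BW.
    by rewrite mulr_ge0 ?exprn_ge0 // mulr_ge0 ?sqr_ge0.
  have : 0 <= (B * W ^+ 2 * D) * (W ^+ 3 * X) by rewrite mulr_ge0.
  by rewrite sqrrD; lra.
have KL : (Num.truncn (2 * N))%:R <= L.
  by apply: (le_trans le2); rewrite /L; nra.
apply: (le_trans (reflect LY KL)); rewrite -/q.
apply: (@le_trans _ _ (W * (L * E + (2 * B * W ^+ 2 * D + W ^+ 3 * X)))).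
  by rewrite ler_wpM2l ?lerD2l //; lra.
have -> : W * (L * E + (2 * B * W ^+ 2 * D + W ^+ 3 * X)) =
   B * (W * (N * E)) + B * (W * D) + 2 * B * (W ^+ 3 * D) + W ^+ 4 * X.
  by rewrite /L /D; ring.
have NE0 : 0 <= N * E by rewrite mulr_ge0 //.
have W4 : W <= W ^+ 4 by rewrite ler_eXnr //; lra.
have W34 : W ^+ 3 <= W ^+ 4 by rewrite ler_weXn2l.
have WX : 0 <= W ^+ 4 * X by rewrite mulr_ge0 ?exprn_ge0 //.
have u1 := ler_wpM2l B0 (ler_wpM2r NE0 W4).
have u2 := ler_wpM2l B0 (ler_wpM2r D0 W4).
have u3 := ler_wpM2l B0 (ler_wpM2r D0 W34).
have v1 : 0 <= B * (W ^+ 4 * (N * E)) by rewrite !mulr_ge0 ?exprn_ge0.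
have v2 := ler_wpM2r WX B2.
have v3 : 0 <= B * (W ^+ 4 * D) by rewrite mulr_ge0 // mulr_ge0 ?exprn_ge0.
rewrite -/D; lra.
Qed.

End Bootstrap.

(** * Reflection and squaring with a uniform loss factor *)

Lemma ltn_size_divisors_exp2 (l : nat) : (l < size (divisors (2 ^ l)))%N.
Proof.
rewrite -[l.+1](size_iota 0) -(size_map (fun j => 2 ^ j)%N).
apply: uniq_leq_size.
  by rewrite map_inj_uniq ?iota_uniq // => i j /eqP; rewrite eqn_exp2l // => /eqP.
move=> _ /mapP[j + ->]; rewrite mem_iota add0n ltnS => jl.
by rewrite -dvdn_divisors ?expn_gt0 // dvdn_exp2l.
Qed.

(** 600 exceeds both 18 * 200 / 7 and 36, the coefficients in [reflection] once the energy bound is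
    inserted. *)
Definition reflection_const (R : realType) : R := 816 * 600 / cos 1.

Lemma reflection_const_ge1 (R : realType) : 1 <= reflection_const R.
Proof.
have c1 := cos_le1 (1 : R).
by rewrite /reflection_const ler_pdivlMr ?cos1_gt0 //; lra.
Qed.

Section Uniform.
Variables (R : realType) (k : nat) (A : {fset R}) (T y D : R).
Hypotheses (k0 : (0 < k)%N) (T1 : 1 <= T) (Ty : k%:R * T <= y) (D1 : 1 <= D).
Hypothesis AT : forall t : R, t \in A -> 0 <= t <= T.
Hypothesis divisors_le :
  forall n : nat, (0 < n)%N -> n%:R <= 4 * y -> (size (divisors n))%:R <= D.

Let tau := @alt_sum R A k.
Let G := weighted_pair_sum tau.
Let E : R := (additive_energy k A)%:R.
(** Of the four factors [D], two bound the squared number of dyadic blocks, one the divisors met on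
    the way to the top window, and one the number of dual blocks. *)
Let W : R := reflection_const R * D ^+ 4.

Let kT1 : 1 <= k%:R * T.
Proof. by rewrite -[leLHS]mulr1 ler_pM // ler1n. Qed.

Let y1 : 1 <= y.
Proof. exact: le_trans kT1 Ty. Qed.

(* [2 ^ l] has [l + 1] divisors, so logarithms obey the divisor bound. *)
Let log_le l : (2 ^ l)%:R <= 4 * y -> l.+1%:R <= D.
Proof.
move=> ly; apply: le_trans (divisors_le _ ly); last by rewrite expn_gt0.
by rewrite ler_nat ltn_size_divisors_exp2.
Qed.

Let W1 : 1 <= W.
Proof.
rewrite -[leLHS]mulr1; apply: ler_pM => //; last by rewrite exprn_ege1.
exact: reflection_const_ge1.
Qed.

(** With 2^lam <= L < 2^(lam+1), the sum is moved to the window at 2^lam and reflected there with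
    frequencies bounded by k T. *)
Lemma weighted_pair_sum_reflect (L : R) (K : nat) : 1 <= L <= y -> K%:R <= L ->
  G K <= W * (L * E + G (Num.truncn (2 * k%:R * T / L))).
Proof.
case/andP=> L1 Ly KL.
have L0 : 0 < L := lt_le_trans ltr01 L1.
have D0 : 0 <= D := le_trans ler01 D1.
have kT0 : 0 <= 2 * k%:R * T by rewrite mulr_ge0 // (le_trans ler01 T1).
pose lam := trunc_log 2 (Num.truncn L).
have tL0 : (0 < Num.truncn L)%N by rewrite truncn_ge_nat // ltW.
have lamL : (2 ^ lam)%:R <= L.
  by rewrite -truncn_ge_nat ?trunc_logP // ltW.
have Ll : L < (2 ^ lam.+1)%:R.
  apply: lt_le_trans (truncnS_gt L) _.
  by rewrite ler_nat trunc_log_ltn.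
have Kl : (K < 2 ^ lam.+1)%N by rewrite -(ltr_nat R) (le_lt_trans KL).
have l0 : (0 < 2 ^ lam)%N by rewrite expn_gt0.
have lR0 : 0 < (2 ^ lam)%:R :> R by rewrite ltr0n.
have F0 := @trig_sum_alt_sum_ge0 R k A.
have dd n : (0 < n < 4 * 2 ^ lam)%N -> (size (divisors n))%:R <= D.
  case/andP=> n0 nl; apply: divisors_le => //.
  have : n%:R <= 4 * (2 ^ lam)%:R :> R by rewrite -natrM ler_nat ltnW.
  by lra.
have step1 := weighted_pair_sum_le_window F0 Kl dd.
have := @reflection R _ tau F0 (k%:R * T) (2 ^ lam) kT1 (alt_sum_norm_le AT) l0.
set H := Num.truncn _; set J := up_log 2 H.+1; set P := pair_sum _ _.
move=> step2.
have Hle : H%:R <= k%:R * T / (32 * (2 ^ lam)%:R).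
  have -> : k%:R * T / (32 * (2 ^ lam)%:R) =
      (8 * (8 * (2 ^ lam)%:R * (2 * (k%:R * T))^-1))^-1.
    have : k%:R * T != 0 by rewrite gt_eqF // (lt_le_trans _ kT1).
    have : (2 ^ lam)%:R != 0 :> R by rewrite gt_eqF.
    by move: (k%:R * T) (2 ^ lam)%:R => x z x0 z0; field; rewrite x0 z0.
  rewrite truncn_le invr_ge0 !mulr_ge0 ?invr_ge0 ?mulr_ge0 //.
  exact: le_trans ler01 T1.
have Hy : H%:R <= y.
  apply: (le_trans Hle); rewrite ler_pdivrMr; last by rewrite mulr_gt0.
  have : 1 <= (2 ^ lam)%:R :> R by rewrite ler1n.
  have [h1 h2] := conj Ty y1; nra.
(* For positive [H], minimality of [J] gives 2^(J-1) <= H <= y, and [log_le] at J - 1 bounds J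
   itself. *)
have JD : J%:R <= D.
  have [H0|H0] := posnP H; first by rewrite /J H0 up_log1.
  have J0 : (0 < J)%N by rewrite up_log_gt0 /= ltnS.
  rewrite -(prednK J0); apply: log_le.
  have : (2 ^ J.-1 <= H)%N by rewrite -ltnS up_log_gtn.
  rewrite -(ler_nat R) => /le_trans; apply; apply: (le_trans Hy).
  by rewrite ler_peMl ?(le_trans ler01 y1) // ler1n.
(* Here 18 H <= (18/32) k T / 2^lam, while L < 2 * 2^lam makes 2 k T / L larger than k T / 2^lam. *)
have HL : (18 * H <= Num.truncn (2 * k%:R * T / L))%N.
  rewrite truncn_ge_nat ?divr_ge0 ?(ltW L0) // natrM ler_pdivlMr //.
  move: Hle; rewrite ler_pdivlMr ?mulr_gt0 // => Hle.
  have H0 : 0 <= H%:R :> R by [].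
  have := ler_wpM2l H0 (ltW Ll); rewrite expnS natrM; have := kT1; lra.
have GH := weighted_pair_sum_le F0 HL; rewrite -/G in GH step2.
have G0 : 0 <= G (Num.truncn (2 * k%:R * T / L)) by exact: weighted_pair_sum_ge0.
have E0 : 0 <= E by [].
have energy : \sum_i (1 + tau i ^+ 2)^-1 <= 18 * E.
  by apply: sum_inv_alt_sum_le => t /AT /andP[].
have c0 := cos1_gt0 R.
have P0 : 0 <= P by exact: pair_sum_ge0.
set g := G (Num.truncn _) in GH G0 *.
have step3 : P / (2 ^ lam)%:R <= reflection_const R * D * (L * E + g).
  rewrite -[X in _ <= X](_ : (816 * 600) * (D * (L * E + g)) / cos 1 = _); last first.
    by rewrite /reflection_const; ring.
  rewrite ler_pdivlMr // (_ : _ * cos 1 = cos 1 * P / (2 ^ lam)%:R); last by ring.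
  apply: (le_trans step2).
  have b1 : (2 ^ lam)%:R * \sum_i (1 + tau i ^+ 2)^-1 <= 18 * (D * (L * E)).
    apply: (@le_trans _ _ ((2 ^ lam)%:R * (18 * E))); first by rewrite ler_wpM2l.
    have : (2 ^ lam)%:R * E <= L * E by rewrite ler_wpM2r.
    have : L * E <= D * (L * E) by rewrite ler_peMl // mulr_ge0 // ltW.
    by lra.
  have b2 : J%:R * G (18 * H)%N <= D * g.
    by apply: ler_pM => //; exact: weighted_pair_sum_ge0.
  have : 0 <= D * (L * E) by rewrite mulr_ge0 // mulr_ge0 // ltW.
  have : 0 <= D * g by rewrite mulr_ge0.
  by lra.
apply: (le_trans step1); rewrite -/P.
have lD : lam.+1%:R <= D.
  apply: log_le; apply: (le_trans lamL); apply: (le_trans Ly).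
  by rewrite ler_peMl ?(le_trans ler01 y1) // ler1n.
apply: (@le_trans _ _ (D ^+ 3 * (reflection_const R * D * (L * E + g)))); last first.
  by rewrite /W le_eqVlt; apply/orP; left; apply/eqP; ring.
apply: ler_pM => //.
- by rewrite mulr_ge0 ?exprn_ge0.
- by rewrite divr_ge0 ?(ltW lR0).
by rewrite [D ^+ 3]exprSr ler_pM ?exprn_ge0 // ler_sqr ?nnegrE.
Qed.

Lemma weighted_pair_sum_square (K : nat) : (K * K)%:R <= y ->
  G K ^+ 2 <= #|{: {ffun 'I_(k + k) -> A}}|%:R * W ^+ 2 * G (K * K).
Proof.
move=> KKy; have F0 := @trig_sum_alt_sum_ge0 R k A.
have D0 : 0 <= D by have := D1; lra.
have dd n : (0 < n <= K * K)%N -> (size (divisors n))%:R <= D.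
  case/andP=> n0 nK; apply: divisors_le => //.
  have : n%:R <= (K * K)%:R :> R by rewrite ler_nat.
  by have := y1; lra.
apply: (le_trans (sqr_weighted_pair_sum_le F0 D0 dd)).
rewrite -mulrA ler_wpM2l // ler_wpM2r ?weighted_pair_sum_ge0 //.
rewrite ler_sqr ?nnegrE //; last by have := W1; lra.
apply: (@le_trans _ _ (1 * D ^+ 4)); first by rewrite mul1r ler_eXnr.
by rewrite ler_wpM2r ?exprn_ge0 // reflection_const_ge1.
Qed.

End Uniform.

(** * The mean value estimate *)

#[local] Opaque reflection_const.

Lemma additive_energy_bounds (R : realType) (k : nat) (A : {fset R}) :
  A != fset0 ->
  (0 < additive_energy k A <= #|{: {ffun 'I_(k + k) -> A}}|)%N.
Proof.
case/fset0Pn => a aA; rewrite /additive_energy max_card andbT.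
apply/card_gt0P; exists [ffun=> [` aA]%fset]; rewrite inE /alt_sum.
under eq_bigr do rewrite ffunE.
under [X in _ - X]eq_bigr do rewrite ffunE.
by rewrite subrr normr0 ler01.
Qed.

Lemma energy_mean_square_fset0 (R : realType) (k : nat) (N : R)
    (a : nat -> complex R) : (0 < k)%N -> energy_mean_square k fset0 N a = 0.
Proof.
case: k => // k _; rewrite /energy_mean_square big1 // => t _.
by have := valP (t ord0); rewrite inE.
Qed.

Lemma powR_expn (R : realType) (x r : R) (n : nat) : 0 <= x ->
  (x `^ r) ^+ n = x `^ (r * n%:R).
Proof. by move=> x0; rewrite powRrM powR_mulrn ?powR_ge0. Qed.

Lemma energy_mean_square_bounds (R : realType) (k : nat) (eps : R) :
  (0 < k)%N -> 0 < eps -> exists2 K : R, 0 <= K &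
  forall (N T : R) (A : {fset R}) (a : nat -> complex R),
    1 <= N -> 1 <= T ->
    (forall t : R, t \in A -> 0 <= t <= T) ->
    (forall n : nat, Normc.normc (a n) <= 1) ->
    let X : R := #|` A|%:R ^+ (2 * k) in
    let E : R := (additive_energy k A)%:R in
    let D : R := T `^ (1 / 2) * #|` A|%:R `^ (k%:R / 2) * E `^ (3 / 4) in
    energy_mean_square k A N a <= K * (N * T) `^ eps * (X + N * E + D) /\
    (T `^ (2 / 3) <= N \/ T `^ (2 / 3) * E <= X ->
      energy_mean_square k A N a <= K * (N * T) `^ eps * (X + N * E)).
Proof.
(* The bootstrap loses W^4 and [W] contains the fourth power of the divisor bound, so that bound
   enters to the power 16. *)
move=> k0 e0; pose e := eps / 16.
have e1 : 0 < e by rewrite divr_gt0.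
have [C C1 HC] := size_divisors_le e1.
have cc : 0 <= reflection_const R := le_trans ler01 (reflection_const_ge1 R).
have [W1 W1E] : exists W1 : R, W1 = reflection_const R * (C * (16 * k%:R) `^ e) ^+ 4.
  by eexists.
have W10 : 0 <= W1.
  rewrite W1E; apply: mulr_ge0 => //; apply: exprn_ge0.
  by apply: mulr_ge0; [exact: le_trans ler01 C1|exact: powR_ge0].
exists (16 * k%:R * W1 ^+ 4); first by rewrite !mulr_ge0 ?exprn_ge0.
move=> N T A a N1 T1 AT a1 X E D.
have N0 : 0 <= N := le_trans ler01 N1.
have T0 : 0 <= T := le_trans ler01 T1.
have X0 : 0 <= X by rewrite exprn_ge0.
have E0 : 0 <= E by [].
have D0 : 0 <= D by rewrite !mulr_ge0 ?powR_ge0.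
have NE0 : 0 <= N * E by rewrite mulr_ge0.
pose c := 16 * k%:R * W1 ^+ 4 * (N * T) `^ eps.
have c0 : 0 <= c by rewrite !mulr_ge0 ?powR_ge0 ?exprn_ge0.
rewrite -/c; have [->|A0] := eqVneq A fset0.
  by rewrite energy_mean_square_fset0 //; split=> [|_]; rewrite mulr_ge0 ?addr_ge0.
have /andP[E1 EX] := additive_energy_bounds k A0.
have XE : X = #|{: {ffun 'I_(k + k) -> A}}|%:R.
  by rewrite card_ffun card_ord -cardfE natrX addnn -mul2n.
have {}E1 : 1 <= E by rewrite ler1n.
have {}EX : E <= X by rewrite XE ler_nat.
pose B : R := 2 * k%:R; pose y := 2 * B * (N * T).
have k1 : 1 <= k%:R :> R by rewrite ler1n.
have B2 : 2 <= B by rewrite /B; lra.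
have NT1 : 1 <= N * T by rewrite -[leLHS]mulr1 ler_pM.
have TNT : T <= N * T by rewrite ler_peMl.
have Ty : k%:R * T <= y.
  have := ler_wpM2l (ler0n R k) TNT.
  have : 0 <= k%:R * (N * T) by rewrite !mulr_ge0.
  by rewrite /y /B; lra.
have y1 : 1 <= 4 * y by rewrite /y /B; nra.
have [d dE] : exists d : R, d = C * (4 * y) `^ e by eexists.
have d1 : 1 <= d.
  rewrite dE -[leLHS]mulr1 ler_pM // -[leLHS](powRr0 (4 * y)) //.
  by rewrite ler_powR // ltW.
have dd n : (0 < n)%N -> n%:R <= 4 * y -> (size (divisors n))%:R <= d.
  move=> n0 ny; apply: (le_trans (HC n n0)); rewrite dE ler_wpM2l //.
    exact: le_trans C1.
  by apply: (ge0_ler_powR (ltW e1)); rewrite ?nnegrE // (le_trans ler01 y1).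
have [W WE] : exists W : R, W = reflection_const R * d ^+ 4 by eexists.
have W_1 : 1 <= W.
  rewrite WE -[leLHS]mulr1; apply: ler_pM => //.
    exact: reflection_const_ge1.
  by rewrite exprn_ege1.
(* The spare factor 2 serves the case t E <= X, in which X + t E is replaced by 2 X. *)
have W4 : 4 * B * W ^+ 4 * 2 = c.
  have dE' : d = C * (16 * k%:R) `^ e * (N * T) `^ e.
    rewrite dE -mulrA -powRM ?mulr_ge0 //; congr (_ * _ `^ _).
    by rewrite /y /B; ring.
  have W4E : W ^+ 4 = W1 ^+ 4 * (N * T) `^ eps.
    have -> : (N * T) `^ eps = ((N * T) `^ e) ^+ 16.
      by rewrite powR_expn ?mulr_ge0 // /e divfK.
    by rewrite WE W1E dE'; ring.
  by rewrite W4E /c /B; ring.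
have F0 := @trig_sum_alt_sum_ge0 R k A.
pose G := weighted_pair_sum (@alt_sum R A k).
have G0 K : 0 <= G K by exact: weighted_pair_sum_ge0.
have Gm K K' : (K <= K')%N -> G K <= G K' by move=> ?; exact: weighted_pair_sum_le.
have refl L K : 1 <= L <= y -> K%:R <= L ->
    G K <= W * (L * E + G (Num.truncn (B * T / L))).
  by rewrite WE; exact: weighted_pair_sum_reflect.
have sq K : (K * K)%:R <= y -> G K ^+ 2 <= X * W ^+ 2 * G (K * K)%N.
  by rewrite XE WE; exact: (weighted_pair_sum_square A k0 T1 Ty d1 dd).
have en : energy_mean_square k A N a <= G (Num.truncn (2 * N)).
  exact: energy_mean_square_le.
have large := bootstrap_large G0 Gm N1 T1 B2 W_1 E1 EX refl sq.
have cube := bootstrap_cube_root G0 Gm N1 T1 B2 W_1 E1 EX refl sq.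
have short := bootstrap_short G0 Gm N1 T1 B2 W_1 E1 EX refl sq.
pose t := T `^ (2 / 3).
have tT : t ^+ 3 = T ^+ 2.
  by rewrite powR_expn // -powR_mulrn //; congr (_ `^ _); field.
have t1 : 1 <= t by rewrite -[leLHS](powRr0 T) // ler_powR // divr_ge0.
have t0 : 0 <= t := le_trans ler01 t1.
have E_gt0 : 0 < E := lt_le_trans ltr01 E1.
have EN0 : E != 0 by rewrite gt_eqF.
have w0 : 0 <= 4 * B * W ^+ 4.
  have W0 := le_trans ler01 W_1; have B0 := le_trans (ler0n R 2) B2.
  by apply: mulr_ge0; [apply: mulr_ge0|apply: exprn_ge0].
have halfc (z : R) : 0 <= z -> 4 * B * W ^+ 4 * z <= c * z.
  move=> z0; rewrite -W4; move: (mulr_ge0 w0 z0); move: (4 * B * W ^+ 4) => w.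
  by rewrite -mulrA mulrCA mulr_natl mulr2n => wz; rewrite lerDl.
have Nt : T ^+ 2 <= N ^+ 3 \/ N <= t.
  have [Nt|/ltW tN] := leP N t; [by right|left].
  by rewrite -tT ler_pXn2r.
split.
  case: Nt => [/large le1|Nt].
    apply: (le_trans en); apply: (le_trans le1).
    apply: (le_trans (halfc _ _)); first by rewrite addr_ge0.
    by rewrite ler_wpM2l // lerDl.
  (* With this choice M E is the third term and M^4 E = D^4 / E^3 = T^2 X, as [bootstrap_short]
     requires. *)
  pose M := D / E.
  have ME : M * E = D by rewrite divfK.
  have D4 : D ^+ 4 = T ^+ 2 * X * E ^+ 3.
    have cA0 : 0 <= #|` A|%:R :> R by [].
    rewrite /D /X !exprMn !powR_expn // -(powR_mulrn 2 T0) -(powR_mulrn 3 E0).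
    rewrite -(powR_mulrn (2 * k) cA0).
    congr (_ `^ _ * _ `^ _ * _ `^ _); first by field.
      by rewrite natrM; field.
    by field.
  have M4 : M ^+ 4 * E = T ^+ 2 * X.
    apply: (mulIf (expf_neq0 3 EN0)); rewrite -D4 -ME; ring.
  have M0 : 0 < M.
    rewrite lt_neqAle divr_ge0 // andbT; apply/eqP => M0.
    move: M4; rewrite -M0 expr0n mul0r => /esym/eqP.
    have X_gt0 : 0 < X := lt_le_trans E_gt0 EX.
    have T_gt0 : 0 < T := lt_le_trans ltr01 T1.
    by rewrite mulf_eq0 expf_eq0 /= !gt_eqF.
  (* If M exceeds t, then t E <= D and the cube root bound already suffices. *)
  have [Mt|/ltW tM] := leP M t.
    apply: (le_trans en); apply: (le_trans (short t M tT t1 Nt M0 Mt M4)).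
    by rewrite ME; apply: halfc; rewrite !addr_ge0.
  apply: (le_trans en); apply: (le_trans (cube t t1 tT Nt)).
  have tE : t * E <= D by rewrite -ME ler_wpM2r.
  apply: (le_trans (halfc _ _)).
    by rewrite addr_ge0 // mulr_ge0.
  by rewrite ler_wpM2l // lerD // lerDl.
move=> cond.
(* For N below t the second alternative in [cond] lets X absorb the term t E. *)
have [TN|{}Nt] : T ^+ 2 <= N ^+ 3 \/ (N <= t /\ t * E <= X).
  case: cond => [tN|tX]; last by case: Nt; [left|right].
  by left; rewrite -tT ler_pXn2r.
  apply: (le_trans en); apply: (le_trans (large TN)).
  by apply: halfc; rewrite addr_ge0.
case: Nt => Nt tX; apply: (le_trans en); apply: (le_trans (cube t t1 tT Nt)).
apply: (@le_trans _ _ (4 * B * W ^+ 4 * (2 * X))).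
  by rewrite ler_wpM2l // mulr2n mulrDl mul1r lerD2l.
by rewrite mulrA W4 ler_wpM2l // lerDl.
Qed.

Theorem theorem17 (R : realType) (k : nat) (eps delta C : R) :
  (0 < k)%N -> 0 < eps -> 0 < delta ->
  exists K : R,
  forall (N T : R) (A : {fset R}) (a : nat -> complex R),
    1 <= N -> 1 <= T ->
    T `^ delta <= N -> N <= T `^ C ->
    (forall t : R, t \in A -> 0 <= t <= T) ->
    well_spaced A ->
    (forall n : nat, Normc.normc (a n) <= 1) ->
    let cardA : R := #|` A|%:R in
    let Tk : R := (additive_energy k A)%:R in
    energy_mean_square k A N a <=
      K * (cardA ^+ (2 * k) + N * Tk
           + T `^ (1 / 2) * cardA `^ (k%:R / 2) * Tk `^ (3 / 4)) * N `^ eps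
    /\
    (T `^ (2 / 3) <= N \/ T `^ (2 / 3) * Tk <= cardA ^+ (2 * k) ->
     energy_mean_square k A N a <=
       K * (cardA ^+ (2 * k) + N * Tk) * (N * T) `^ eps).
Proof.
(* From T^delta <= N one gets T <= N^(1/delta), so (N T)^e is at most N to the power (1 + 1/delta) e
   = eps. *)
move=> k0 e0 d0; pose e := eps / (1 + delta^-1).
have dd : 0 < delta^-1 by rewrite invr_gt0.
have e1 : 0 < e by rewrite divr_gt0 // addr_gt0.
have [K K0 HK] := energy_mean_square_bounds k0 e1.
exists K => N T A a N1 T1 TN _ AT _ a1 cardA Tk.
have [b1 b2] := HK N T A a N1 T1 AT a1.
have N0 : 0 <= N := le_trans ler01 N1.
have T0 : 0 <= T := le_trans ler01 T1.
have NT1 : 1 <= N * T by rewrite -[leLHS]mulr1 ler_pM.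
have dd0 : 0 < 1 + delta^-1 by rewrite addr_gt0.
have ee : e <= eps by rewrite ler_pdivrMr // ler_peMr ?lerDl // ltW.
have TdN : T <= N `^ delta^-1.
  have -> : T = (T `^ delta) `^ delta^-1.
    by rewrite -powRrM mulfV ?gt_eqF // powRr1.
  by rewrite ge0_ler_powR ?nnegrE ?powR_ge0 // ltW.
have NTe : (N * T) `^ e <= N `^ eps.
  have -> : eps = (1 + delta^-1) * e by rewrite mulrC divfK // gt_eqF.
  rewrite [N `^ _]powRrM; apply: (ge0_ler_powR (ltW e1));
    rewrite ?nnegrE ?powR_ge0 ?mulr_ge0 //.
  rewrite powRD; last by apply/implyP => _; rewrite gt_eqF // (lt_le_trans ltr01 N1).
  by rewrite powRr1 // ler_wpM2l.
split=> [|cond].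
  apply: (le_trans b1); rewrite -!mulrA ler_wpM2l // mulrC ler_wpM2l //.
  by rewrite !addr_ge0 ?mulr_ge0 ?powR_ge0 ?exprn_ge0.
apply: (le_trans (b2 cond)); rewrite -!mulrA ler_wpM2l // mulrC ler_wpM2l //.
  by rewrite addr_ge0 ?mulr_ge0 ?exprn_ge0.
by rewrite ler_powR.
Qed.
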